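(* Let $K_1$ and $K_2$ be compact metric spaces. Then the pair $(C(K_1),C(K_2))$ of real Banach spaces has the BPBZp.
   Context: $C(K)$ is here the real Banach space of real-valued continuous functions on $K$ with the supremum norm. $S_X$ is the unit sphere of a Banach space $X$, $X^*$ its topological dual, $\mathcal{L}(X,Y)$ the bounded linear operators from $X$ to $Y$. BPBZp (Bishop-Phelps-Bollobás-Zizler property): a pair $(X,Y)$ of Banach spaces has the BPBZp if for every $\varepsilon>0$ there exists $\eta(\varepsilon)>0$ such that whenever $T\in\mathcal{L}(X,Y)$ with $\|T\|=1$, $y_0^*\in S_{Y^*}$ and $x_0\in S_X$ satisfy $|y_0^*(Tx_0)|>1-\eta(\varepsilon)$, there exist $y_1^*\in S_{Y^*}$, $x_1\in S_X$ and $S\in\mathcal{L}(X,Y)$ with $\|S\|=|y_1^*(Sx_1)|=1$, $\|x_1-x_0\|<\varepsilon$, $\|y_1^*-y_0^*\|<\varepsilon$ and $\|S-T\|<\varepsilon$. *)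

(* Defs.v *)
From HB Require Import structures.
From mathcomp Require Import all_boot all_order all_algebra.
From mathcomp Require Import all_classical all_reals all_analysis.
From mathcomp Require Import ring.

Set Implicit Arguments.
Unset Strict Implicit.
Unset Printing Implicit Defensive.

Import Order.TTheory GRing.Theory Num.Theory.
Import numFieldNormedType.Exports.

Local Open Scope classical_set_scope.
Local Open Scope ring_scope.

(* C(K) is a fresh name for [continuousType K R]: the library may put other
   topologies on [continuousType], and the sup norm needs compactness, hence
   the proof argument. [K] may be empty, in which case C(K) = {0}. *)
Definition contfun (R : realType) (K : metricType R)
  (cK : compact [set: K]) : Type := continuousType K R.

Section contfun_zmodule.
Context {R : realType} {K : metricType R} (cK : compact [set: K]).
Local Notation C := (contfun cK).

HB.instance Definition _ := Choice.copy C (continuousType K R).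

Lemma contfunP (f g : C) : (f : K -> R) =1 (g : K -> R) -> f = g.
Proof. by move=> fg; apply/continuousEP. Qed.

Lemma contfun_cts (f : C) : continuous (f : K -> R).
Proof. exact: (@cts_fun _ _ (f : continuousType K R)). Qed.

Lemma contfun_add_cts (f g : C) : continuous (fun x => f x + g x).
Proof. by move=> x; apply: cvgD; exact: contfun_cts. Qed.

Lemma contfun_opp_cts (f : C) : continuous (fun x => - f x).
Proof. by move=> x; apply: cvgN; exact: contfun_cts. Qed.

Lemma contfun_scale_cts (a : R) (f : C) : continuous (fun x => a * f x).
Proof. by move=> x; apply: cvgM; [exact: cvg_cst|exact: contfun_cts]. Qed.

Definition contfun_zero : C := cst (0 : R) : continuousType K R.
Definition contfun_opp (f : C) : C :=
  mkcts (@contfun_opp_cts f) : continuousType K R.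
Definition contfun_add (f g : C) : C :=
  mkcts (@contfun_add_cts f g) : continuousType K R.
Definition contfun_scale (a : R) (f : C) : C :=
  mkcts (@contfun_scale_cts a f) : continuousType K R.

Lemma contfun_addA : associative contfun_add.
Proof. by move=> f g h; apply: contfunP => x /=; exact: addrA. Qed.
Lemma contfun_addC : commutative contfun_add.
Proof. by move=> f g; apply: contfunP => x /=; exact: addrC. Qed.
Lemma contfun_add0 : left_id contfun_zero contfun_add.
Proof. by move=> f; apply: contfunP => x /=; exact: add0r. Qed.
Lemma contfun_addN : left_inverse contfun_zero contfun_opp contfun_add.
Proof. by move=> f; apply: contfunP => x /=; exact: addNr. Qed.

HB.instance Definition _ := GRing.isZmodule.Build C
  contfun_addA contfun_addC contfun_add0 contfun_addN.

Lemma contfun_scaleA (a b : R) (f : C) :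
  contfun_scale a (contfun_scale b f) = contfun_scale (a * b) f.
Proof. by apply: contfunP => x /=; exact: mulrA. Qed.
Lemma contfun_scale1 : left_id 1 contfun_scale.
Proof. by move=> f; apply: contfunP => x /=; exact: mul1r. Qed.
Lemma contfun_scaleDr : right_distributive contfun_scale +%R.
Proof. by move=> a f g; apply: contfunP => x /=; exact: mulrDr. Qed.
Lemma contfun_scaleDl (f : C) : {morph contfun_scale^~ f : a b / a + b}.
Proof. by move=> a b; apply: contfunP => x /=; exact: mulrDl. Qed.

HB.instance Definition _ := GRing.Zmodule_isLmodule.Build R C
  contfun_scaleA contfun_scale1 contfun_scaleDr contfun_scaleDl.

Lemma contfunD (f g : C) (x : K) : (f + g) x = f x + g x.
Proof. by []. Qed.
Lemma contfunN (f : C) (x : K) : (- f) x = - f x.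
Proof. by []. Qed.
Lemma contfunZ (a : R) (f : C) (x : K) : (a *: f) x = a * f x.
Proof. by []. Qed.

Definition sup_norm (f : C) : R := sup (range (fun x : K => `|f x|)).

Lemma sup_norm_has_ub (f : C) : has_ubound (range (fun x : K => `|f x|)).
Proof.
have cf : compact (f @` [set: K]).
  apply: continuous_compact => //.
  by apply/continuous_subspaceT; exact: contfun_cts.
have [M [_ fM]] := compact_bounded cf.
exists (M + 1) => _ [x _ <-].
by apply: (fM (M + 1)); [rewrite ltrDl|exists x].
Qed.

Lemma sup_norm_ge (f : C) (x : K) : `|f x| <= sup_norm f.
Proof. by apply: ub_le_sup; [exact: sup_norm_has_ub|exists x]. Qed.

Lemma sup_norm_ge0 (f : C) : 0 <= sup_norm f.
Proof.
have [[x _]|K0] := pselect (exists x : K, True).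
  exact: le_trans (sup_norm_ge f x).
rewrite /sup_norm (_ : [set _ | _ in _] = set0) ?sup0//.
by rewrite -subset0; move=> t [x _ _]; apply: K0; exists x.
Qed.

Lemma sup_norm_le (f : C) (M : R) :
  0 <= M -> (forall x, `|f x| <= M) -> sup_norm f <= M.
Proof.
move=> M0 fM; have [[x _]|K0] := pselect (exists x : K, True).
  apply: ge_sup; first by exists `|f x|, x.
  by move=> _ [y _ <-]; exact: fM.
rewrite /sup_norm (_ : [set _ | _ in _] = set0) ?sup0//.
by rewrite -subset0; move=> t [x _ _]; apply: K0; exists x.
Qed.

Lemma sup_normD (f g : C) : sup_norm (f + g) <= sup_norm f + sup_norm g.
Proof.
apply: sup_norm_le => [|x]; first by rewrite addr_ge0 ?sup_norm_ge0.
by rewrite contfunD (le_trans (ler_normD _ _))// lerD ?sup_norm_ge.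
Qed.

Lemma sup_normZ_le (a : R) (f : C) : sup_norm (a *: f) <= `|a| * sup_norm f.
Proof.
apply: sup_norm_le => [|x]; first by rewrite mulr_ge0 ?sup_norm_ge0.
by rewrite contfunZ normrM ler_wpM2l ?sup_norm_ge.
Qed.

Lemma sup_normZ (a : R) (f : C) : sup_norm (a *: f) = `|a| * sup_norm f.
Proof.
apply/eqP; rewrite eq_le sup_normZ_le /=.
have [->|a0] := eqVneq a 0; first by rewrite normr0 mul0r sup_norm_ge0.
rewrite -ler_pdivlMl ?normr_gt0// -normfV.
by rewrite (le_trans _ (sup_normZ_le _ _))// scalerA mulVf// scale1r.
Qed.

Lemma sup_norm_eq0 (f : C) : sup_norm f = 0 -> f = 0.
Proof.
move=> f0; apply: contfunP => x.
by apply/eqP; rewrite -normr_le0 -f0 sup_norm_ge.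
Qed.

HB.instance Definition _ :=
  @Lmodule_isNormed.Build R C sup_norm sup_normD sup_normZ sup_norm_eq0.

Lemma contfun_normE (f : C) : `|f| = sup (range (fun x : K => `|f x|)).
Proof. by []. Qed.

End contfun_zmodule.

Section contfun_complete.
Context {R : realType} {K : metricType R} (cK : compact [set: K]).
Local Notation C := (contfun cK).

Lemma contfun_cauchy_cvg (F : set_system C) :
  ProperFilter F -> cauchy F -> cvg F.
Proof.
move=> FF /cauchyP Fc.
have Fnear (e : R) : 0 < e ->
    exists f : C, \forall g \near F, forall x : K, `|f x - (g : C) x| < e.
  move=> e0; have [f Ff] := Fc e e0; exists f.
  apply: filterS Ff => g; rewrite -ball_normE /= => fg x.
  by apply: le_lt_trans fg; exact: (sup_norm_ge (f - g)).
pose ev (x : K) (f : C) : R := f x.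
have evc (x : K) : cvg (ev x @ F).
  apply: cauchy_cvg; apply/cauchyP => e e0; have [f Ff] := Fnear e e0.
  exists (f x); apply: filterS Ff => g /(_ x).
  by rewrite -ball_normE.
pose l (x : K) : R := lim (ev x @ F).
have Fl (e : R) : 0 < e -> \forall g \near F, forall x, `|l x - (g : C) x| <= e.
  move=> e0; have e20 : 0 < e / 2 by rewrite divr_gt0.
  have [f Ff] := Fnear (e / 2) e20.
  have lf x : `|l x - f x| <= e / 2.
    rewrite distrC; apply/ler_addgt0Pr => d d0.
    have : \forall g \near F, `|l x - ev x g| <= d.
      by move/cvgrPdist_le : (evc x); exact.
    move=> lg; have [g [/= gl gf]] := filter_ex (filterI lg Ff).
    rewrite (le_trans (ler_distD (g x) _ _))// lerD//; first exact/ltW.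
    by rewrite distrC.
  apply: filterS Ff => g fg x.
  by rewrite (le_trans (ler_distD (f x) _ _))// (splitr e) lerD// ltW.
have lcts : continuous l.
  move=> x; apply/cvgrPdist_le => e e0.
  have e30 : 0 < e / 3 by rewrite divr_gt0.
  have [g gl] := filter_ex (Fl _ e30).
  have := @contfun_cts _ _ _ g x; move=> /cvgrPdist_le/(_ _ e30).
  apply: filterS => y gxy.
  rewrite (_ : e = e / 3 + (e / 3 + e / 3)); last first.
    by field.
  rewrite (le_trans (ler_distD (g x) _ _))// lerD//.
  by rewrite (le_trans (ler_distD (g y) _ _))// lerD// distrC.
pose L : C := mkcts lcts : continuousType K R.
apply/cvg_ex; exists L; apply/cvgrPdist_le => e e0.
by apply: filterS (Fl e e0) => g lg; apply: sup_norm_le => //; exact: ltW.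
Qed.

HB.instance Definition _ := Uniform_isComplete.Build C contfun_cauchy_cvg.

End contfun_complete.

Definition bounded_operator (R : realType) (X Y : normedModType R)
  (T : X -> Y) : Prop := exists M : R, forall x : X, `|T x| <= M * `|x|.

(* Only meaningful for bounded operators: [sup] of an unbounded set is 0. *)
Definition opnorm (R : realType) (X Y : normedModType R) (T : X -> Y) : R :=
  sup [set `|T x| | x in [set x : X | `|x| <= 1]].

Definition BPBZp (R : realType) (X Y : completeNormedModType R) : Prop :=
  forall eps : R, 0 < eps -> exists2 eta : R, 0 < eta &
    forall (T : {linear X -> Y}) (y0 : {linear Y -> R^o}) (x0 : X),
      bounded_operator T -> opnorm T = 1 ->
      continuous y0 -> opnorm y0 = 1 ->
      `|x0| = 1 ->
      `|y0 (T x0)| > 1 - eta ->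
      exists (y1 : {linear Y -> R^o}) (x1 : X) (S : {linear X -> Y}),
        [/\ continuous y1 /\ opnorm y1 = 1,
            `|x1| = 1,
            bounded_operator S,
            opnorm S = 1 /\ `|y1 (S x1)| = 1 &
            [/\ `|x1 - x0| < eps,
                opnorm (y1 \- y0) < eps &
                opnorm (S \- T) < eps]].

(* Main.v *)
(* Regard T as the weak* continuous family of functionals mu_t f = T f t.
   Where T x0 t is close to a sign b, mu_t is almost carried by the set where
   |x0| is close to 1, and b mu_t has there almost the sign of x0. After
   multiplication by a cut-off of x0 and a cut-off of T x0 this becomes a family
   of functionals whose negative parts have small norm. The positive parts do not
   depend continuously on t, but the convex sets of positive functionals lam with
   ||lam - mu_t^+|| < ||mu_t^-|| + eps depend on t in a lower semicontinuous way,
   and since C(K1) is separable a selection in the style of Michael gives a positive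
   operator near the given family. Normalizing it and gluing it with T produces S,
   with S x1 equal to a sign wherever T x0 is close to that sign; y1 is a normalized
   restriction of the positive and negative parts of y0 to these regions. *)

From HB Require Import structures.
Require Import Defs.
From mathcomp Require Import all_boot all_order all_algebra.
From mathcomp Require Import all_classical all_reals all_analysis.
From mathcomp Require Import ring lra zify.

Set Implicit Arguments.
Unset Strict Implicit.
Unset Printing Implicit Defensive.

Import Order.TTheory GRing.Theory Num.Theory.
Import numFieldNormedType.Exports.

Local Open Scope classical_set_scope.
Local Open Scope ring_scope.

(** Positivity is the crux. The mass of a positive functional is its value at the constant 1, hence
    continuous in t along an operator into C(K2), so dividing by it gives an operator again and
    makes the norm exactly 1. For signed families the norm is only lower semicontinuous in t.
    Measures occur only as linear functionals on C(K): restricting a measure means multiplying by a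
    continuous cut-off, and ramps with nested thresholds replace indicator functions, each being 1
    up to sign on the support of the next. The operator and the functional are modified
    independently; they share only the function T x0 and the threshold 1 - d/2. For a wanted
    closeness a, a defect 2d of T x0 t from a sign leaves norm at most 8d/a to the part of mu_t that
    the cut-off removes, whence d = a^2/32; a defect eta of y0 (T x0) costs 8 eta/d, whence eta =
    a^3/512. *)

(** * Uniform continuity and partitions of unity on a compact metric space *)

Section contfun_basics.
Context {R : realType} {K : metricType R} {cK : compact [set: K]}.
Local Notation C := (contfun cK).
Implicit Types f g : C.

Definition mkcontfun (F : K -> R) (cF : continuous F) : C :=
  mkcts cF : continuousType K R.

Lemma mkcontfunE (F : K -> R) (cF : continuous F) x : mkcontfun cF x = F x.
Proof. by []. Qed.

Lemma contfun_mul_cts f g : continuous (fun x => f x * g x).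
Proof. by move=> x; apply: cvgM; exact: contfun_cts. Qed.
Definition cmul f g : C := mkcontfun (@contfun_mul_cts f g).

Lemma cmulE f g x : cmul f g x = f x * g x.
Proof. by []. Qed.

Lemma contfun_comp_cts (phi : R -> R) (cphi : continuous phi) f :
  continuous (fun x => phi (f x)).
Proof. by move=> x; apply: continuous_comp; [exact: contfun_cts|exact: cphi]. Qed.
Definition ccomp (phi : R -> R) (cphi : continuous phi) f : C :=
  mkcontfun (@contfun_comp_cts phi cphi f).

Lemma contfun_min_cts f g : continuous (fun x => Num.min (f x) (g x)).
Proof. by move=> x; apply: continuous_min; exact: contfun_cts. Qed.
Definition cmin f g : C := mkcontfun (@contfun_min_cts f g).

Lemma cminE f g x : cmin f g x = Num.min (f x) (g x).
Proof. by []. Qed.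

Lemma contfun_cst_cts (a : R) : continuous (fun _ : K => a).
Proof. by move=> x; exact: cvg_cst. Qed.
Definition ccst (a : R) : C := mkcontfun (@contfun_cst_cts a).

Lemma ccstE (a : R) x : ccst a x = a.
Proof. by []. Qed.

Lemma contfunB f g x : (f - g) x = f x - g x.
Proof. by rewrite contfunD contfunN. Qed.

Lemma contfun_sum (I : Type) (s : seq I) (F : I -> C) x :
  (\sum_(i <- s) F i) x = \sum_(i <- s) F i x.
Proof. by elim: s => [|i s IH]; rewrite ?big_nil// !big_cons contfunD IH. Qed.

Lemma le_contfun_norm f x : `|f x| <= `|f|.
Proof. exact: sup_norm_ge. Qed.

Lemma contfun_norm_le f (M : R) :
  0 <= M -> (forall x, `|f x| <= M) -> `|f| <= M.
Proof. exact: sup_norm_le. Qed.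

Lemma contfun_unit_range f x : `|f| <= 1 -> -1 <= f x <= 1.
Proof. by move=> f1; rewrite -ler_norml (le_trans (le_contfun_norm f x)). Qed.

Lemma ccst_norm_le (a : R) : `|ccst a| <= `|a|.
Proof. exact: contfun_norm_le. Qed.

Lemma metric_finite_net (r : K -> R) : (forall x, 0 < r x) ->
  exists s : seq K, forall y, exists2 x, x \in s & mdist x y < r x.
Proof.
move=> r0.
(* The filter of finite lists directed by inclusion turns the near-covering form of compactness into
   the existence of a finite subcover. *)
pose F : set_system (seq K) := filter_from setT
  (fun s : seq K => [set s' : seq K | {subset s <= s'}]).
have FF : Filter F.
  apply: filter_from_filter; first by exists [::].
  move=> s s' _ _; exists (s ++ s') => // t st.
  by split=> x xs; apply: st; rewrite mem_cat xs ?orbT.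
have /compact_near_coveringP/(_ _ F
  (fun s y => exists2 x, x \in s & mdist x y < r x) FF) := cK.
case=> [x _|s _ /(_ s)]; last first.
  by move=> h; exists s => y; exact: h.
exists (ball x (r x), [set s : seq K | x \in s]) => /=.
  split; first exact: nbhsx_ballx.
  by exists [:: x] => // s; apply; rewrite inE.
by move=> [y s] /= [xy xs]; exists x => //; move: xy; rewrite ballEmdist.
Qed.

Lemma contfun_near f x (e : R) : 0 < e ->
  exists2 r, 0 < r & forall y, mdist x y < r -> `|f x - f y| < e.
Proof.
move=> e0; have /cvgrPdist_lt/(_ _ e0) := @contfun_cts _ _ _ f x.
move=> /metricType_numDomainType.nbhs_mdistP[r/= r0 fr].
by exists r => // y /fr.
Qed.

Lemma contfun_unif f (e : R) : 0 < e ->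
  exists2 r, 0 < r & forall x y, mdist x y < r -> `|f x - f y| < e.
Proof.
move=> e0; have e20 : 0 < e / 2 by rewrite divr_gt0.
have /choice[r rP] x : exists r, 0 < r /\
    forall y, mdist x y < r -> `|f x - f y| < e / 2.
  by have [r r0 h] := contfun_near f x e20; exists r.
have [|s sP] := @metric_finite_net (fun x => r x / 2).
  by move=> x; rewrite divr_gt0// (rP x).1.
have [d [d0 ds]] : exists d, 0 < d /\ forall x, x \in s -> d <= r x / 2.
  elim: s {sP} => [|x s [d [d0 ds]]]; first by exists 1.
  exists (Num.min d (r x / 2)); split.
    by rewrite lt_min d0 divr_gt0// (rP x).1.
  move=> y; rewrite inE => /orP[/eqP->|/ds]; first by rewrite ge_min lexx orbT.
  by rewrite ge_min => ->.
exists d => // y z yz; have [x xs xy] := sP y; have [r0 rx] := rP x.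
have h1 : `|f x - f y| < e / 2 by apply: rx; lra.
have h2 : `|f x - f z| < e / 2.
  apply: rx; have := ds _ xs; have := metric_triangle x y z; lra.
rewrite (le_lt_trans (ler_distD (f x) _ _))// (splitr e) ltrD//.
by rewrite distrC.
Qed.

Lemma contfun_seq_unif (F : seq C) (e : R) : 0 < e ->
  exists2 r, 0 < r & forall f, f \in F ->
    forall x y, mdist x y < r -> `|f x - f y| < e.
Proof.
move=> e0; elim: F => [|f F [r r0 rF]]; first by exists 1.
have [r' r'0 rf] := contfun_unif f e0.
exists (Num.min r r'); first by rewrite lt_min r0.
move=> g; rewrite inE => /orP[/eqP->|gF] x y; rewrite lt_min => /andP[xr xr'].
  exact: rf.
exact: rF.
Qed.

Lemma mdist_cts (x : K) : continuous (mdist x).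
Proof.
move=> y; apply/cvgrPdist_lt => e e0.
apply/metricType_numDomainType.nbhs_mdistP; exists e => // z /= yz.
rewrite ltr_norml; have := metric_triangle x y z; have := metric_triangle x z y.
by rewrite (metric_sym z y); lra.
Qed.

Lemma bump_cts (x : K) (r : R) : continuous (fun y => Num.max 0 (r - mdist x y)).
Proof.
move=> y; apply: (@continuous_max R K (fun=> 0) (fun z => r - mdist x z)).
  exact: cvg_cst.
by apply: cvgB; [exact: cvg_cst|exact: mdist_cts].
Qed.

(** Normalized tents over a finite net. The radius may vary with the centre, as the gluing of local
    selections over [K2] requires. *)
Lemma partition_of_unity (r : K -> R) : (forall x, 0 < r x) ->
  exists (s : seq K) (phi : K -> C),
    [/\ forall x y, 0 <= phi x y,
        forall y, \sum_(x <- s) phi x y = 1 &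
        forall x y, phi x y != 0 -> mdist x y < r x].
Proof.
move=> r0; have [s sP] := metric_finite_net r0.
pose b x y := Num.max 0 (r x - mdist x y).
have b0 x y : 0 <= b x y by rewrite le_max lexx.
pose D : K -> R := fun y => \sum_(x <- s) b x y.
have D0 y : 0 < D y.
  have [x xs xy] := sP y.
  have bx : 0 < b x y by rewrite lt_max subr_gt0 xy orbT.
  rewrite lt_neqAle sumr_ge0// andbT eq_sym; apply/negP => /eqP Dy.
  have : D y == 0 by apply/eqP.
  by rewrite /D psumr_eq0// => /allP/(_ _ xs) /=; rewrite gt_eqF.
have cD : continuous D.
  rewrite /D; elim: (s) => [|x s' IH].
    rewrite (_ : (fun _ => _) = fun=> 0); first by move=> y; exact: cvg_cst.
    by apply/funext => y; rewrite big_nil.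
  rewrite (_ : (fun _ => _) = fun y => b x y + \sum_(x <- s') b x y).
    by move=> y; apply: cvgD; [exact: bump_cts|exact: IH].
  by apply/funext => y; rewrite big_cons.
have cphi x : continuous (fun y => b x y / D y).
  move=> y; apply: cvgM; first exact: bump_cts.
  by apply: cvgV; [rewrite gt_eqF|exact: cD].
exists s, (fun x => mkcontfun (@cphi x)); split => [x y|y|x y].
- by rewrite mkcontfunE divr_ge0// ltW.
- under eq_bigr do rewrite mkcontfunE.
  by rewrite -mulr_suml -/(D y) divff//; apply: lt0r_neq0.
- apply: contraNT; rewrite -leNgt mkcontfunE => xy.
  by rewrite /b max_l ?mul0r// subr_le0.
Qed.

End contfun_basics.

(** * Linear functionals and their positive parts *)

(** An unbundled predicate, since the functionals below come from choice, finite sums and limits;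
    they are bundled only at the very end. *)
Definition linf (R : realType) (V : lmodType R) (l : V -> R) : Prop :=
  forall (a : R) (f g : V), l (a *: f + g) = a * l f + l g.

Section linf_theory.
Context {R : realType} {V : lmodType R} {l : V -> R} (hl : linf l).

Lemma linfD f g : l (f + g) = l f + l g.
Proof. by rewrite -{1}(scale1r f) hl mul1r. Qed.

Lemma linf0 : l 0 = 0.
Proof. by apply: (addrI (l 0)); rewrite -linfD !addr0. Qed.

Lemma linfZ a f : l (a *: f) = a * l f.
Proof. by rewrite -[a *: f]addr0 hl linf0 addr0. Qed.

Lemma linfN f : l (- f) = - l f.
Proof. by rewrite -scaleN1r linfZ mulN1r. Qed.

Lemma linfB f g : l (f - g) = l f - l g.
Proof. by rewrite linfD linfN. Qed.

Lemma linf_sum (I : Type) (s : seq I) (F : I -> V) :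
  l (\sum_(i <- s) F i) = \sum_(i <- s) l (F i).
Proof. by elim: s => [|i s IH]; rewrite ?big_nil ?linf0// !big_cons linfD IH. Qed.

End linf_theory.

Section positive_functionals.
Context {R : realType} {K : metricType R} {cK : compact [set: K]}.
Local Notation C := (contfun cK).
Implicit Types (f g h : C) (l : C -> R).

Definition cnneg f : Prop := forall x, 0 <= f x.

(** Stands for a finite positive measure; its norm is [l cone], by [positive_norm_le]. *)
Definition positive l : Prop := linf l /\ forall f, cnneg f -> 0 <= l f.

Lemma cnnegD f g : cnneg f -> cnneg g -> cnneg (f + g).
Proof. by move=> f0 g0 x; rewrite contfunD addr_ge0. Qed.

Lemma cnnegZ a f : 0 <= a -> cnneg f -> cnneg (a *: f).
Proof. by move=> a0 f0 x; rewrite contfunZ mulr_ge0. Qed.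

Lemma cnneg0 : cnneg 0.
Proof. by move=> x; exact: lexx. Qed.

Lemma cnneg_cst a : 0 <= a -> cnneg (ccst a).
Proof. by move=> a0 x; rewrite ccstE. Qed.

Lemma contfun_norm_mono f g : cnneg f -> (forall x, f x <= g x) -> `|f| <= `|g|.
Proof.
move=> f0 fg; apply: contfun_norm_le => // x.
rewrite ger0_norm// (le_trans (fg x))// (le_trans _ (le_contfun_norm g x))//.
exact: ler_norm.
Qed.

(** Every [f] is the difference of the nonnegative functions [f + c] and [c], with [c] the constant
    [|f|]; additivity of [p] makes the resulting value independent of the choice of [c], which is
    [PE]. *)
Lemma cnneg_extend (p : C -> R) :
  (forall f g, cnneg f -> cnneg g -> p (f + g) = p f + p g) ->
  (forall (a : R) f, 0 <= a -> cnneg f -> p (a *: f) = a * p f) ->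
  exists P : C -> R, linf P /\ forall f, cnneg f -> P f = p f.
Proof.
move=> pD pZ; pose P f := p (f + ccst `|f|) - p (ccst `|f|).
have shift f : cnneg (f + ccst `|f|).
  move=> x; rewrite contfunD ccstE.
  by have := le_contfun_norm f x; rewrite ler_norml; lra.
have PE f c : cnneg c -> cnneg (f + c) -> P f = p (f + c) - p c.
  move=> c0 fc0; have n0 : cnneg (ccst `|f|) by exact: cnneg_cst.
  apply/eqP; rewrite /P subr_eq addrAC eq_sym subr_eq eq_sym; apply/eqP.
  by rewrite -(pD _ _ (shift f) c0) -(pD _ _ fc0 n0) addrAC.
have PD f g : P (f + g) = P f + P g.
  have cf : cnneg (ccst `|f|) by exact: cnneg_cst.
  have cg : cnneg (ccst `|g|) by exact: cnneg_cst.
  rewrite (PE (f + g) (ccst `|f| + ccst `|g|)); last 2 first.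
  - exact: cnnegD.
  - by rewrite addrACA; exact: cnnegD.
  by rewrite addrACA (pD _ _ (shift f) (shift g)) (pD _ _ cf cg) /P; ring.
have P0 : P 0 = 0 by apply: (addrI (P 0)); rewrite -PD !addr0.
have PN f : P (- f) = - P f by apply/eqP; rewrite -addr_eq0 -PD addNr P0.
have PZ0 a f : 0 <= a -> P (a *: f) = a * P f.
  move=> a0; rewrite (PE _ (a *: ccst `|f|)) -?scalerDr.
  - by rewrite (pZ _ _ a0 (shift f)) (pZ _ _ a0 (cnneg_cst (normr_ge0 f))) -mulrBr.
  - by apply: cnnegZ => //; exact: cnneg_cst.
  - exact: cnnegZ.
have PZ a f : P (a *: f) = a * P f.
  have [a0|a0] := leP 0 a; first exact: PZ0.
  by apply: oppr_inj; rewrite -PN -scaleNr PZ0 ?oppr_ge0 ?mulNr// ltW.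
exists P; split=> [a f g|f f0]; first by rewrite PD PZ.
rewrite (PE _ 0)// ?addr0//.
by have := pD 0 0 cnneg0 cnneg0; rewrite addr0 => h; lra.
Qed.

(** Riesz formula: on nonnegative [f] the positive part is the supremum of [l g] over [0 <= g <= f].
    The last clause keeps the near attainment of this supremum, from which lower semicontinuity in a
    parameter is later read off. *)
Lemma positive_part_exists l (M : R) : linf l -> (forall f, `|l f| <= M * `|f|) ->
  exists P : C -> R, [/\ positive P, forall f, cnneg f -> l f <= P f &
    forall f (e : R), cnneg f -> 0 < e ->
      exists g, [/\ cnneg g, forall x, g x <= f x & P f < l g + e]].
Proof.
move=> hl lM.
pose A f := [set l g | g in [set g | cnneg g /\ forall x, g x <= f x]].
pose p f := sup (A f).
have Aub f : has_ubound (A f).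
  exists (`|M| * `|f|) => _ [g [g0 gf] <-].
  rewrite (le_trans (ler_norm _))// (le_trans (lM g))//.
  rewrite (@le_trans _ _ (`|M| * `|g|))// ?ler_wpM2r ?ler_norm//.
  by rewrite ler_wpM2l// contfun_norm_mono.
have A0 f : cnneg f -> A f !=set0.
  by move=> f0; exists (l 0), 0 => //; split; [exact: cnneg0|exact: f0].
have Ap f g : cnneg g -> (forall x, g x <= f x) -> l g <= p f.
  by move=> g0 gf; apply: ub_le_sup => //; exists g.
have pA f e : cnneg f -> 0 < e ->
    exists g, [/\ cnneg g, forall x, g x <= f x & p f < l g + e].
  move=> f0 e0; have [_ [g [g0 gf] <-]] := sup_adherent e0 (conj (A0 _ f0) (Aub f)).
  by rewrite ltrBlDr => ?; exists g.
have pD f g : cnneg f -> cnneg g -> p (f + g) = p f + p g.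
  move=> f0 g0; apply/eqP; rewrite eq_le; apply/andP; split.
    apply: ge_sup; first exact/A0/cnnegD.
    move=> _ [h [h0 hfg] <-].
    (* Riesz decomposition: [h <= f + g] splits into [min h f], below [f], and the remainder, below
       [g]. *)
    rewrite -(subrK (cmin h f) h) addrC linfD// lerD//; apply: Ap.
    - by move=> x; rewrite cminE le_min h0 f0.
    - by move=> x; rewrite cminE ge_min lexx orbT.
    - by move=> x; rewrite contfunB cminE subr_ge0 ge_min lexx.
    - move=> x; rewrite contfunB cminE; have := hfg x; rewrite contfunD.
      by rewrite lerBlDr minElt; case: ifP => _; have := g0 x; lra.
  apply/ler_addgt0Pr => e e0; have e20 : 0 < e / 2 by rewrite divr_gt0.
  have [f' [f'0 ff' lf']] := pA f _ f0 e20.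
  have [g' [g'0 gg' lg']] := pA g _ g0 e20.
  have : l (f' + g') <= p (f + g).
    by apply: Ap => [|x]; [exact: cnnegD|rewrite !contfunD lerD].
  by rewrite linfD//; lra.
have pZ_le a f : 0 < a -> cnneg f -> a * p f <= p (a *: f).
  move=> a0 f0; rewrite -ler_pdivlMl//; apply: ge_sup; first exact: A0.
  move=> _ [g [g0 gf] <-]; rewrite ler_pdivlMl// -linfZ//; apply: Ap.
    exact/cnnegZ/g0/ltW.
  by move=> x; rewrite !contfunZ ler_pM2l.
have pZ a f : 0 <= a -> cnneg f -> p (a *: f) = a * p f.
  rewrite le_eqVlt => /orP[/eqP<- f0|a0 f0].
    have := pD 0 0 cnneg0 cnneg0; rewrite scale0r mul0r addr0 => h; lra.
  apply/eqP; rewrite eq_le pZ_le// andbT -ler_pdivrMl//.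
  rewrite (le_trans (pZ_le _ _ _ _)) ?invr_gt0//; first exact/cnnegZ/f0/ltW.
  by rewrite scalerA mulVf ?scale1r// gt_eqF.
have [P [lP PE]] := cnneg_extend pD pZ.
exists P; split.
- split=> // f f0; rewrite PE// -(linf0 hl); exact: Ap.
- by move=> f f0; rewrite PE//; exact: Ap.
- by move=> f e f0 e0; rewrite PE//; exact: pA.
Qed.

End positive_functionals.

Section weighted_means.
Context {R : realType} {I : eqType}.
Variables (s : seq I) (w : I -> R).
Hypotheses (w0 : forall i, 0 <= w i) (w1 : \sum_(i <- s) w i = 1).

Lemma weighted_subr (v : I -> R) (a : R) :
  \sum_(i <- s) w i * v i - a = \sum_(i <- s) w i * (v i - a).
Proof.
under [RHS]eq_bigr do rewrite mulrBr.
by rewrite sumrB -mulr_suml w1 mul1r.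
Qed.

Lemma weighted_dist_le (v : I -> R) (a e : R) :
  (forall i, i \in s -> w i != 0 -> `|v i - a| <= e) ->
  `|\sum_(i <- s) w i * v i - a| <= e.
Proof.
move=> H; rewrite weighted_subr (le_trans (ler_norm_sum _ _ _))//.
rewrite (_ : e = \sum_(i <- s) w i * e); last by rewrite -mulr_suml w1 mul1r.
rewrite big_seq [leRHS]big_seq ler_sum// => i si; rewrite normrM ger0_norm//.
have [->|wi] := eqVneq (w i) 0; first by rewrite !mul0r.
by rewrite ler_wpM2l// H.
Qed.

Lemma weighted_lt (v : I -> R) (a : R) :
  (forall i, v i < a) -> \sum_(i <- s) w i * v i < a.
Proof.
move=> va; rewrite lt_neqAle; apply/andP; split; last first.
  rewrite -subr_le0 weighted_subr -oppr_ge0 -sumrN sumr_ge0// => i _.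
  by rewrite -mulrN mulr_ge0// opprB subr_ge0 ltW.
rewrite -subr_eq0 weighted_subr -oppr_eq0 -sumrN psumr_eq0; last first.
  by move=> i _; rewrite -mulrN mulr_ge0// opprB subr_ge0 ltW.
(* Equality would make every weight vanish, since each [v i < a] is strict. *)
apply/negP => /allP h; have : \sum_(i <- s) w i = 0.
  rewrite big_seq big1// => i /h /=; rewrite -mulrN mulf_eq0 oppr_eq0 subr_eq0.
  by rewrite (lt_eqF (va i)) orbF => /eqP.
by rewrite w1 => /eqP; rewrite oner_eq0.
Qed.

End weighted_means.

(** * Estimates for positive functionals and weak* testing lists *)

Section positive_functionals_more.
Context {R : realType} {K : metricType R} {cK : compact [set: K]}.
Local Notation C := (contfun cK).
Implicit Types (f g h : C) (l : C -> R).

(** To be read c-one: the constant function 1, not a cone. *)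
Definition cone : C := ccst 1.

Lemma cone_norm_le : `|cone| <= 1.
Proof. by rewrite (le_trans (ccst_norm_le 1))// normr1. Qed.

Lemma cnneg_cone : cnneg cone.
Proof. exact: cnneg_cst. Qed.

Lemma positive_abs_le l f g : positive l ->
  (forall x, `|f x| <= g x) -> `|l f| <= l g.
Proof.
move=> [ll l0] fg; have f1 x : -g x <= f x <= g x by rewrite -ler_norml.
have h1 : 0 <= l (g - f) by apply: l0 => x; rewrite contfunB; have := f1 x; lra.
have h2 : 0 <= l (g + f) by apply: l0 => x; rewrite contfunD; have := f1 x; lra.
by move: h1 h2; rewrite linfB// linfD// ler_norml; lra.
Qed.

Lemma positive_le l f g : positive l -> (forall x, f x <= g x) -> l f <= l g.
Proof.
move=> [ll l0] fg; rewrite -subr_ge0 -linfB//; apply: l0 => x.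
by rewrite contfunB subr_ge0.
Qed.

Lemma positive_norm_le l f : positive l -> `|l f| <= l cone * `|f|.
Proof.
move=> pl; rewrite mulrC -(linfZ pl.1); apply: positive_abs_le => // x.
by rewrite contfunZ ccstE mulr1 le_contfun_norm.
Qed.

Lemma linf_cmul l h : linf l -> linf (fun f => l (cmul h f)).
Proof.
move=> ll a f g; rewrite -ll; congr l; apply: contfunP => x.
by rewrite cmulE !contfunD !contfunZ !cmulE; ring.
Qed.

Lemma linf_sum_fun (V : lmodType R) (I : Type) (s : seq I) (w : I -> R)
    (L : I -> V -> R) : (forall i, linf (L i)) ->
  linf (fun v => \sum_(i <- s) w i * L i v).
Proof.
move=> hL a f g; rewrite mulr_sumr -big_split/=; apply: eq_bigr => i _.
by rewrite hL; ring.
Qed.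

Lemma positive_sum (I : Type) (s : seq I) (w : I -> R) (L : I -> C -> R) :
  (forall i, 0 <= w i) -> (forall i, positive (L i)) ->
  positive (fun f => \sum_(i <- s) w i * L i f).
Proof.
move=> w0 pL; split; first by apply: linf_sum_fun => i; exact: (pL i).1.
by move=> f f0; apply: sumr_ge0 => i _; rewrite mulr_ge0// (pL i).2.
Qed.

Lemma partition_sum (s : seq K) (phi : K -> C) :
  (forall y, \sum_(x <- s) phi x y = 1) -> \sum_(x <- s) phi x = cone.
Proof. by move=> h; apply: contfunP => y; rewrite contfun_sum h. Qed.

Lemma partition_split (s : seq K) (phi : K -> C) l f : linf l ->
  (forall y, \sum_(x <- s) phi x y = 1) ->
  l f = \sum_(x <- s) l (cmul (phi x) f).
Proof.
move=> ll h; rewrite -linf_sum//; congr l; apply: contfunP => y.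
rewrite contfun_sum; under eq_bigr do rewrite cmulE.
by rewrite -mulr_suml h mul1r.
Qed.

(** On the support of [phi] the function [f] is within [e] of [f x], and positivity integrates this
    pointwise bound. *)
Lemma positive_osc l (phi f : C) (r e : R) (x : K) : positive l -> cnneg phi ->
  (forall y, phi y != 0 -> mdist x y < r) ->
  (forall y, mdist x y < r -> `|f x - f y| < e) ->
  `|l (cmul phi f) - f x * l phi| <= e * l phi.
Proof.
move=> pl phi0 phir fr; rewrite -!(linfZ pl.1) -(linfB pl.1).
apply: positive_abs_le => // y.
rewrite contfunB !contfunZ cmulE.
have [->|h] := eqVneq (phi y) 0; first by rewrite mul0r !mulr0 subr0 normr0.
rewrite (_ : _ - _ = phi y * (f y - f x)); last by ring.
rewrite normrM (ger0_norm (phi0 y)) mulrC ler_wpM2r// distrC ltW//.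
exact/fr/phir.
Qed.

(* A countable substitute for a dense sequence: on norm-bounded sets of
   functionals, smallness on the finite lists [G k] is weak* smallness. *)
Lemma separating_family : exists G : nat -> seq C,
  [/\ forall k, {subset G k <= G k.+1}, forall k, cone \in G k &
    forall (B : R) f (e : R), 0 < e -> exists k (eta : R), 0 < eta /\
      forall l, linf l -> (forall g, `|l g| <= B * `|g|) ->
        (forall g, g \in G k -> `|l g| <= eta) -> `|l f| <= e].
Proof.
have /choice[sphi H] (n : nat) : exists sphi : seq K * (K -> C),
    [/\ forall x y, 0 <= sphi.2 x y,
        forall y, \sum_(x <- sphi.1) sphi.2 x y = 1 &
        forall x y, sphi.2 x y != 0 -> mdist x y < n.+1%:R^-1].
  have [|s [phi h]] := @partition_of_unity _ _ cK (fun=> n.+1%:R^-1).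
    by move=> _; rewrite invr_gt0.
  by exists (s, phi).
pose s n := (sphi n).1; pose phi n := (sphi n).2.
(* Collecting the partitions of all orders up to [k] makes the lists nested. *)
pose G k := cone :: flatten [seq map (phi n) (s n) | n <- iota 0 k.+1].
exists G; split.
- move=> k f; rewrite !in_cons => /orP[->//|/flattenP[u /mapP[n + ->] fn]].
  rewrite mem_iota => nk; apply/orP; right; apply/flattenP.
  exists (map (phi n) (s n)) => //.
  by apply/mapP; exists n => //; rewrite mem_iota; lia.
- by move=> k; rewrite inE eqxx.
move=> B f e e0.
have B0 : 0 < 2 * (`|B| + 1) by have := normr_ge0 B; lra.
have [r r0 fr] := contfun_unif f (divr_gt0 e0 B0).
have [n nr] : exists n : nat, n.+1%:R^-1 < r.
  have [n _ /(_ n (leqnn n))] := near_infty_natSinv_lt (PosNum r0).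
  by move=> h; exists n.
pose A := \sum_(x <- s n) `|f x|.
have A0 : 0 <= A by apply: sumr_ge0.
exists n, (e / (2 * (A + 1))); split; first by rewrite divr_gt0//; lra.
move=> l ll lB lG.
have [phi0 phi1 phir] := H n.
(* The interpolation of [f] at the nodes: [l (f - h)] is small by the bound [B], and [l h] involves
   only values of [l] on [G n]. *)
pose h := \sum_(x <- s n) f x *: phi n x.
have fh : `|f - h| <= e / (2 * (`|B| + 1)).
  apply: contfun_norm_le => [|y]; first by rewrite divr_ge0// ltW.
  rewrite contfunB contfun_sum distrC.
  under eq_bigr do rewrite contfunZ mulrC.
  apply: weighted_dist_le => [x||x _ xy]; [exact: phi0|exact: phi1|].
  rewrite ltW//; apply: fr.
  exact: lt_trans (phir _ _ xy) nr.
have lfh : `|l (f - h)| <= e / 2.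
  rewrite (le_trans (lB _))// (@le_trans _ _ (`|B| * (e / (2 * (`|B| + 1)))))//.
    by rewrite (@le_trans _ _ (`|B| * `|f - h|))// ?ler_wpM2r ?ler_wpM2l ?ler_norm.
  rewrite mulrCA ler_pM2l// ler_pdivrMr//; have := normr_ge0 B; lra.
have lh : `|l h| <= e / 2.
  rewrite /h linf_sum// (le_trans (ler_norm_sum _ _ _))//.
  rewrite (@le_trans _ _ (A * (e / (2 * (A + 1)))))//.
    rewrite mulr_suml big_seq [leRHS]big_seq ler_sum// => x xs.
    rewrite linfZ// normrM ler_wpM2l// lG//.
    rewrite inE; apply/orP; right; apply/flattenP; exists (map (phi n) (s n)).
      by apply/mapP; exists n => //; rewrite mem_iota/= add0n.
    exact: map_f.
  rewrite mulrCA ler_pM2l// ler_pdivrMr; lra.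
rewrite -(subrK h f) linfD// (le_trans (ler_normD _ _))//; lra.
Qed.

End positive_functionals_more.

(** * Selection of a positive operator near an almost positive one *)

Section positive_selection.
Context {R : realType} {K1 K2 : metricType R}.
Context {cK1 : compact [set: K1]} {cK2 : compact [set: K2]}.
Local Notation X := (contfun cK1).
Local Notation Y := (contfun cK2).
Variables (T : X -> Y) (M delta eps : R).
Hypotheses (hT : forall t, linf (fun f => T f t)) (M0 : 0 <= M) (delta0 : 0 <= delta).
Hypothesis TM : forall f, `|T f| <= M * `|f|.
Hypothesis Tdelta : forall f t, cnneg f -> (forall x, f x <= 1) -> - delta <= T f t.
Hypothesis eps0 : 0 < eps.
Variable P : K2 -> X -> R.
Hypothesis P_pos : forall t, positive (P t).
Hypothesis P_ge : forall t f, cnneg f -> T f t <= P t f.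
Hypothesis P_approx : forall t f (e : R), cnneg f -> 0 < e ->
  exists g, [/\ cnneg g, forall x, g x <= f x & P t f < T g t + e].

Local Notation one := (@cone R K1 cK1).

Let excess t := P t one - T one t + eps.

(** The open ball of radius [excess t] around [P t] among positive functionals. The witness [d]
    encodes the strict bound on the norm; the room between [d] and [excess t] is what lower
    semicontinuity consumes. *)
Let Phi t (lam : X -> R) : Prop := positive lam /\
  exists d : R, [/\ 0 <= d, d < excess t & forall f, `|lam f - P t f| <= d * `|f|].

Lemma excess_gt0 t : 0 < excess t.
Proof. have := P_ge t (@cnneg_cone _ _ cK1); rewrite /excess; have := eps0; lra. Qed.

Lemma Phi_P t : Phi t (P t).
Proof.
split=> //; exists 0; split=> //; first exact: excess_gt0.
by move=> f; rewrite subrr normr0 mul0r.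
Qed.

Lemma Phi_convex (s : seq K2) (w : K2 -> R) (lam : K2 -> X -> R) t :
  (forall x, 0 <= w x) -> \sum_(x <- s) w x = 1 -> (forall x, Phi t (lam x)) ->
  Phi t (fun f => \sum_(x <- s) w x * lam x f).
Proof.
move=> w0 w1 H; split.
  by apply: positive_sum => // x; exact: (H x).1.
have /choice[d dP] x := (H x).2.
exists (\sum_(x <- s) w x * d x); split.
- by apply: sumr_ge0 => x _; rewrite mulr_ge0//; have [] := dP x.
- by apply: weighted_lt => // x; have [] := dP x.
- move=> f; rewrite weighted_subr//.
  rewrite (le_trans (ler_norm_sum _ _ _))// mulr_suml ler_sum// => x _.
  rewrite normrM (ger0_norm (w0 x)) -mulrA ler_wpM2l//.
  by have [] := dP x.
Qed.

(* With [p], [n] the masses of the positive and negative parts of the functional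
   [T _ t] on a small cell, [p - n] is continuous in [t] and [n] is only lower
   semicontinuous, but [r |-> `|m - r| - r] is nonincreasing, so [`|m - p| - n]
   is upper semicontinuous. This is why the radius of [Phi t] contains the total
   mass [P t one - T one t] of the negative part. *)
Lemma Phi_lsc t0 lam (F : seq X) (e : R) : Phi t0 lam -> 0 < e ->
  exists2 r, 0 < r & forall t, mdist t0 t < r ->
    exists lam', Phi t lam' /\ forall f, f \in F -> `|lam' f - lam f| <= e.
Proof.
move=> [pl [d [d0 dlt ld]]] e0.
have L0 : 0 <= lam one by apply: pl.2; exact: cnneg_cone.
pose eta := e / (2 * (lam one + 1)).
have eta0 : 0 < eta by rewrite divr_gt0//; lra.
have etaL : 2 * (eta * lam one) <= e.
  have D0 : 0 < 2 * (lam one + 1) by lra.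
  have : eta * (2 * (lam one + 1)) = e by rewrite /eta divfK// gt_eqF.
  by have := eta0; lra.
have [r1 r10 Fr] := contfun_seq_unif F eta0.
have [s [phi [phi0 phi1 phir]]] := @partition_of_unity _ _ cK1 (fun=> r1) (fun=> r10).
have phi_nn x : cnneg (phi x) by move=> y; exact: phi0.
pose c := excess t0 - d; have c0 : 0 < c by rewrite subr_gt0.
pose N : R := (size s)%:R; have N0 : 0 <= N by [].
(* Each of the [N] cells will lose [5 * th], and the total must stay below the room [c]. *)
pose th := c / (5 * N + 1).
have th0 : 0 < th by rewrite divr_gt0//; lra.
have thN : 5 * (th * N) < c.
  have D0 : 0 < 5 * N + 1 by lra.
  have : th * (5 * N + 1) = c by rewrite /th divfK// gt_eqF.
  by have := th0; lra.
(* [T (g x)] is continuous and nearly attains [P t0 (phi x)] at [t0], so [P t (phi x)] cannot drop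
   by more than [2 * th] for [t] near [t0]. *)
have /choice[g gP] x := P_approx t0 (phi_nn x) th0.
have [r r0 rP] := contfun_seq_unif (map (T \o phi) s ++ map (T \o g) s) th0.
exists r => // t tr.
pose m x := lam (phi x); pose p x := P t (phi x).
have m0 x : 0 <= m x by apply: pl.2.
have p0 x : 0 <= p x by apply: (P_pos t).2.
have sum_m : \sum_(x <- s) m x = lam one.
  by rewrite -(linf_sum pl.1) partition_sum.
(* The new functional is [P t] with its mass on each cell corrected from [p x] to [m x]: shrunk by
   the factor [m x / p x] if too large, completed by a point mass [b x] at [x] if too small. The
   total correction is then the sum of the [|m x - p x|]. *)
pose a x := if p x <= m x then 1 else m x / p x.
pose b x := Num.max 0 (m x - p x).
have b0 x : 0 <= b x by rewrite le_max lexx.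
have a0 x : 0 <= a x by rewrite /a; case: ifP => // _; rewrite divr_ge0.
have ap x : a x * p x + b x = m x /\ `|a x - 1| * p x + b x = `|m x - p x|.
  rewrite /a /b; have [pm|mp] := leP (p x) (m x).
    rewrite max_r ?subr_ge0// subrr normr0 ger0_norm ?subr_ge0//; split; lra.
  have px : 0 < p x by exact: le_lt_trans (m0 x) mp.
  rewrite max_l; last by lra.
  rewrite addr0 divfK ?gt_eqF//; split=> //.
  rewrite addr0 ler0_norm; last by rewrite subr_le0 ler_pdivrMr// mul1r ltW.
  rewrite ltr0_norm ?subr_lt0// opprB mulrBl divfK ?gt_eqF//; lra.
pose lam' f := \sum_(x <- s) 1 * (a x * P t (cmul (phi x) f) + b x * f x).
have piece_pos x : positive (fun f => a x * P t (cmul (phi x) f) + b x * f x).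
  split=> [k f f'|f f0].
    by rewrite (linf_cmul (phi x) (P_pos t).1) contfunD contfunZ; ring.
  rewrite addr_ge0// mulr_ge0//; apply: (P_pos t).2 => y.
  by rewrite cmulE mulr_ge0.
exists lam'; split.
  split; first exact: positive_sum.
  exists (\sum_(x <- s) `|m x - p x|); split; first exact: sumr_ge0.
    have main : \sum_(x <- s) `|m x - P t0 (phi x)| <= d.
      (* Testing [lam - P t0] on this signed sum of the partition, of norm at most 1, recovers the
         sum of all the absolute values at once. *)
      pose w : X := \sum_(x <- s) Num.sg (m x - P t0 (phi x)) *: phi x.
      have w1 : `|w| <= 1.
        apply: contfun_norm_le => // y; rewrite contfun_sum.
        rewrite (le_trans (ler_norm_sum _ _ _))// -(phi1 y) ler_sum// => x _.
        rewrite contfunZ normrM (ger0_norm (phi0 x y)) -[leRHS]mul1r ler_wpM2r//.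
        by rewrite normr_sg; case: eqP.
      rewrite (@le_trans _ _ (`|lam w - P t0 w|))//; last first.
        by rewrite (le_trans (ld w))// -[leRHS]mulr1 ler_wpM2l.
      rewrite (le_trans _ (ler_norm _))// (linf_sum pl.1) (linf_sum (P_pos t0).1).
      rewrite -sumrB ler_sum// => x _.
      by rewrite (linfZ pl.1) (linfZ (P_pos t0).1) -mulrBr normrEsg.
    (* If [p x] exceeds [m x], this is the triangle inequality. Otherwise twice the drop of [p x]
       below [P t0 (phi x)] is added, at most [4 * th]; the fifth [th] pays for the change of
       [T (phi x)]. *)
    have each x : x \in s -> `|m x - p x| <= `|m x - P t0 (phi x)| +
        (p x - T (phi x) t) - (P t0 (phi x) - T (phi x) t0) + 5 * th.
      move=> xs; have [g0 gphi gt] := gP x.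
      have Tg : `|T (g x) t0 - T (g x) t| < th.
        by apply: rP => //; rewrite mem_cat; apply/orP; right; exact: (map_f (T \o g)).
      have Tphi : `|T (phi x) t0 - T (phi x) t| < th.
        by apply: rP => //; rewrite mem_cat; apply/orP; left; exact: (map_f (T \o phi)).
      have Pg : T (g x) t <= p x.
        by rewrite (le_trans (P_ge t g0))//; exact: positive_le.
      move: Tg Tphi; rewrite !ltr_norml => Tg Tphi.
      have h1 := ler_norm (m x - P t0 (phi x)).
      have h2 := ler_norm (- (m x - P t0 (phi x))); rewrite normrN in h2.
      rewrite ler_norml; lra.
    have sum_each : \sum_(x <- s) `|m x - p x| <=
        d + (P t one - T one t) - (P t0 one - T one t0) + 5 * (th * N).
      rewrite big_seq (le_trans (ler_sum _ each))// -big_seq.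
      rewrite !big_split/= !sumrN !big_split/= !sumrN.
      have Esum t' : \sum_(x <- s) P t' (phi x) = P t' one.
        by rewrite -(linf_sum (P_pos t').1) partition_sum.
      have ETsum t' : \sum_(x <- s) T (phi x) t' = T one t'.
        by rewrite -(linf_sum (hT t')) partition_sum.
      rewrite !Esum !ETsum big_const_seq count_predT iter_addr_0.
      rewrite -mulr_natr -/N; lra.
    by move: sum_each thN; rewrite /c /excess; lra.
  move=> f; rewrite (partition_split f (P_pos t).1 phi1) -sumrB.
  rewrite (le_trans (ler_norm_sum _ _ _))// mulr_suml ler_sum// => x _.
  rewrite -(ap x).2 mul1r.
  have -> : a x * P t (cmul (phi x) f) + b x * f x - P t (cmul (phi x) f) =
    (a x - 1) * P t (cmul (phi x) f) + b x * f x by ring.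
  rewrite (le_trans (ler_normD _ _))// [leRHS]mulrDl lerD//; last first.
    by rewrite normrM ger0_norm// ler_wpM2l// le_contfun_norm.
  rewrite normrM -mulrA ler_wpM2l// mulrC -(linfZ (P_pos t).1).
  apply: positive_abs_le => // y; rewrite cmulE contfunZ normrM mulrC.
  by rewrite (ger0_norm (phi0 x y)) ler_wpM2r// le_contfun_norm.
(* Both functionals have mass [m x] on the cell of [x], where [f] oscillates by less than [eta];
   hence the error [2 * eta * m x] per cell. *)
move=> f fF; have osc x y : mdist x y < r1 -> `|f x - f y| < eta by exact: Fr.
rewrite (partition_split f pl.1 phi1) -sumrB.
rewrite (le_trans (ler_norm_sum _ _ _))//.
rewrite (@le_trans _ _ (\sum_(x <- s) 2 * (eta * m x)))//; last first.
  by rewrite -!mulr_sumr sum_m.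
apply: ler_sum => x _; rewrite mul1r.
have h1 := positive_osc (P_pos t) (phi_nn x) (phir x) (osc x).
have h2 := positive_osc pl (phi_nn x) (phir x) (osc x).
have -> : a x * P t (cmul (phi x) f) + b x * f x - lam (cmul (phi x) f) =
  a x * (P t (cmul (phi x) f) - f x * p x) - (lam (cmul (phi x) f) - f x * m x).
  by rewrite -(ap x).1; ring.
rewrite (le_trans (ler_normB _ _))// mulr_natl mulr2n lerD//.
rewrite normrM (ger0_norm (a0 x)) (@le_trans _ _ (a x * (eta * p x)))//.
  by rewrite ler_wpM2l.
rewrite mulrCA; apply: ler_wpM2l; first exact: ltW.
by rewrite -(ap x).1 lerDl.
Qed.

(** Approximate selection in the weak* sense: closeness to [Phi t] is tested on finitely many
    functions only. *)
Let near (F : seq X) (e : R) (S : X -> Y) : Prop := forall t,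
  exists lam, Phi t lam /\ forall f, f \in F -> `|lam f - S f t| <= e.

Let posop (S : X -> Y) : Prop := forall t, positive (fun f => S f t).

(** One step of Michael's method: elements of [Phi t0] close to [S] at [t0] persist near [t0] by
    lower semicontinuity, and a partition of unity on [K2] glues them, convexity of [Phi t]
    preserving closeness. The displacement is [e] for the choice of [lam] plus [e] for the
    oscillation of [S f]. *)
Lemma near_step (F : seq X) (e : R) (S : X -> Y) (F' : seq X) (e' : R) :
  0 < e -> 0 < e' -> near F e S ->
  exists S', [/\ posop S', near F' e' S' &
    forall f, f \in F -> forall t, `|S' f t - S f t| <= 2 * e].
Proof.
move=> e0 e'0 /choice[lam lamP].
have [r2 r20 SF] := contfun_seq_unif (map S F) e0.
have /choice[r rP] t0 : exists r, [/\ 0 < r, r <= r2 & forall t, mdist t0 t < r ->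
    exists lam', Phi t lam' /\ forall f, f \in F' -> `|lam' f - lam t0 f| <= e'].
  have [r1 r10 h] := Phi_lsc F' (lamP t0).1 e'0.
  exists (Num.min r1 r2); split; first by rewrite lt_min r10.
    by rewrite ge_min lexx orbT.
  by move=> t; rewrite lt_min => /andP[/h].
have [|s [phi [phi0 phi1 phir]]] := @partition_of_unity _ _ cK2 r.
  by move=> x; have [] := rP x.
pose S' f : Y := \sum_(x <- s) lam x f *: phi x.
have S'E f t : S' f t = \sum_(x <- s) phi x t * lam x f.
  by rewrite contfun_sum; apply: eq_bigr => x _; rewrite contfunZ mulrC.
exists S'; split.
- move=> t; have -> : (fun f => S' f t) = fun f => \sum_(x <- s) phi x t * lam x f.
    by apply/funext => f; rewrite S'E.
  by apply: positive_sum => x; [exact: phi0|exact: (lamP x).1.1].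
(* Where [phi x t = 0] the term does not count, and [P t] serves as a default element of [Phi t]. *)
- move=> t; have /choice[lam' lam'P] x : exists lam', Phi t lam' /\
      (phi x t != 0 -> forall f, f \in F' -> `|lam' f - lam x f| <= e').
    have [xt|xt] := eqVneq (phi x t) 0; first by exists (P t); split; [exact: Phi_P|].
    have [_ _ h] := rP x; have [l [? ?]] := h t (phir _ _ xt).
    by exists l.
  exists (fun f => \sum_(x <- s) phi x t * lam' x f); split.
    by apply: Phi_convex => // x; exact: (lam'P x).1.
  move=> f fF; rewrite S'E -sumrB.
  under eq_bigr do rewrite -mulrBr.
  rewrite -[X in `|X|]subr0; apply: weighted_dist_le => [x||x _ xt];
    [exact: phi0|exact: phi1|].
  by rewrite subr0; exact: (lam'P x).2.
- move=> f fF t; rewrite S'E; apply: weighted_dist_le => [x||x _ xt];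
    [exact: phi0|exact: phi1|].
  have [_ rr2 _] := rP x.
  have h1 : `|S f x - S f t| < e.
    by apply: SF; [exact: map_f|exact: lt_le_trans (phir _ _ xt) rr2].
  have h2 := (lamP x).2 f fF.
  by rewrite (le_trans (ler_distD (S f x) _ _))// mulr_natl mulr2n lerD// ltW.
Qed.

(** The tolerance halves at each stage, so the increments on any function that stays in the lists
    are summable. The recursion starts from the zero operator, which is near on the empty list. *)
Lemma near_sequence (G : nat -> seq X) : exists S : nat -> X -> Y, forall k,
  [/\ posop (S k), near (G k) (2^-1 ^+ k) (S k) &
    forall f, f \in G k -> forall t, `|S k.+1 f t - S k f t| <= 2 * 2^-1 ^+ k].
Proof.
have q0 k : 0 < (2^-1 : R) ^+ k by rewrite exprn_gt0// invr_gt0.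
have n0 : near [::] 1 (fun=> 0) by move=> t; exists (P t); split; [exact: Phi_P|].
have [S0 [pS0 nS0 _]] := near_step (G 0%N) ltr01 (q0 0%N) n0.
have /choice[step stepP] (kS : nat * (X -> Y)) : exists S',
    near (G kS.1) (2^-1 ^+ kS.1) kS.2 ->
    [/\ posop S', near (G kS.1.+1) (2^-1 ^+ kS.1.+1) S' &
    forall f, f \in G kS.1 -> forall t, `|S' f t - kS.2 f t| <= 2 * 2^-1 ^+ kS.1].
  have [h|h] := pselect (near (G kS.1) (2^-1 ^+ kS.1) kS.2); last by exists kS.2.
  by have [S' h'] := near_step (G kS.1.+1) (q0 kS.1) (q0 kS.1.+1) h; exists S'.
pose S := fix S k := if k is j.+1 then step (j, S j) else S0.
have inv k : posop (S k) /\ near (G k) (2^-1 ^+ k) (S k).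
  elim: k => [|k [_ nk]]; first by split.
  by have [] := stepP (k, S k) nk.
exists S => k; have [pk nk] := inv k; split=> //.
by have [_ _] := stepP (k, S k) nk.
Qed.

(** [P t - T _ t] is the negative part, so its norm is its value at [one]; [Tdelta] applied to
    [one - g], with [g] nearly attaining [P t one], bounds that value by [delta]. *)
Lemma P_sub_T_le t f : `|P t f - T f t| <= delta * `|f|.
Proof.
have c0 := @cnneg_cone _ _ cK1.
have pN : positive (fun f => P t f - T f t).
  split=> [a g h|g g0]; first by rewrite (P_pos t).1 hT; ring.
  by rewrite subr_ge0 P_ge.
rewrite (le_trans (positive_norm_le f pN))// ler_wpM2r//.
apply/ler_addgt0Pr => e e0; have [g [g0 g1 gP]] := P_approx t c0 e0.
have : - delta <= T (one - g) t.
  apply: Tdelta => x; rewrite contfunB ccstE.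
    by rewrite subr_ge0; have := g1 x; rewrite ccstE.
  by rewrite lerBlDr lerDl.
rewrite (linfB (hT t)); lra.
Qed.

(** One [delta] is the distance from [P t] to [T], the other, with [eps], bounds the radius of
    [Phi t]. *)
Lemma Phi_dist_T t lam f : Phi t lam -> `|lam f - T f t| <= (2 * delta + eps) * `|f|.
Proof.
move=> [pl [d [d0 dlt dP]]].
have one1 : `|one| <= 1 := @cone_norm_le _ _ cK1.
have dd : d <= delta + eps.
  have := P_sub_T_le t one; have := ler_norm (P t one - T one t).
  have : delta * `|one| <= delta by rewrite -[leRHS]mulr1 ler_wpM2l.
  by move: dlt; rewrite /excess; lra.
rewrite (le_trans (ler_distD (P t f) _ _))//.
rewrite (_ : 2 * delta + eps = (delta + eps) + delta); last by ring.
rewrite mulrDl lerD//; last exact: P_sub_T_le.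
by rewrite (le_trans (dP f))// ler_wpM2r.
Qed.

(** The sequence is Cauchy on each list, uniformly in [t]; since it is uniformly bounded,
    [separating_family] extends this to every [f]. Convergence in the sup norm makes the limit [U f]
    continuous. *)
Lemma positive_operator_near : exists U : X -> Y,
  posop U /\ forall f, `|U f - T f| <= (2 * delta + eps) * `|f|.
Proof.
have [G [Gsub G1 Gsep]] := @separating_family _ _ cK1.
have [S SP] := near_sequence G.
have q0 k : 0 < (2^-1 : R) ^+ k by rewrite exprn_gt0// invr_gt0.
have qle m n : (m <= n)%N -> (2^-1 : R) ^+ n <= 2^-1 ^+ m.
  by move=> mn; rewrite ler_wiXn2l// ?invr_ge0// invf_le1// ler1n.
have Gmono m n : (m <= n)%N -> {subset G m <= G n}.
  elim: n => [|n IH]; first by rewrite leqn0 => /eqP->.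
  by rewrite leq_eqVlt => /orP[/eqP->//|/IH h] f /h /Gsub.
have one1 : `|one| <= 1 := @cone_norm_le _ _ cK1.
pose B : R := `|2 * delta + eps| + M + 1.
have Phi_bound t lam : Phi t lam -> forall f, `|lam f| <= B * `|f|.
  move=> Pl f; rewrite -(subrK (T f t) (lam f)) (le_trans (ler_normD _ _))//.
  have h1 : (2 * delta + eps) * `|f| <= `|2 * delta + eps| * `|f|.
    by rewrite ler_wpM2r// ler_norm.
  have h2 := le_trans (le_contfun_norm (T f) t) (TM f).
  have := Phi_dist_T f Pl; have := normr_ge0 f; rewrite /B; lra.
(* The norm of the positive functional [S k _ t] is its value at [one], which belongs to every list
   and is therefore close to the value of an element of [Phi t]. *)
have S_bound k t f : `|S k f t| <= (B + 1) * `|f|.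
  have [pS nS _] := SP k; rewrite (le_trans (positive_norm_le f (pS t)))// ler_wpM2r//.
  have [lam [Pl /(_ one (G1 k))]] := nS t.
  have := Phi_bound _ _ Pl one; have := qle 0%N k isT; rewrite expr0 => h1 h2 h3.
  have B0 : 0 <= B by rewrite /B addr_ge0// addr_ge0.
  have h4 : B * `|one| <= B by rewrite -[leRHS]mulr1 ler_wpM2l.
  by move: h2 h3; rewrite ler_norml ler_distl; lra.
have S_tail k i g t : g \in G k ->
    `|S (k + i)%N g t - S k g t| <= 4 * 2^-1 ^+ k - 4 * 2^-1 ^+ (k + i).
  move=> gG; elim: i => [|i IH]; first by rewrite addn0 !subrr normr0.
  rewrite addnS (le_trans (ler_distD (S (k + i)%N g t) _ _))//.
  have [_ _ /(_ g _ t)] := SP (k + i)%N.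
  move=> /(_ (Gmono _ _ (leq_addr _ _) _ gG)); rewrite exprS; lra.
have q_small eta : 0 < eta ->
    exists j, forall m, (j <= m)%N -> 4 * (2^-1 : R) ^+ m <= eta.
  move=> eta0; have eta40 : 0 < eta / 4 by rewrite divr_gt0.
  have /cvgrPdist_le/(_ _ eta40)[j _ jP] :
      (fun n => (2^-1 : R) ^+ n) @ \oo --> (0 : R).
    by apply: cvg_expr; rewrite ger0_norm ?invr_ge0// invf_lt1// ltr1n.
  exists j => m /jP /=; rewrite sub0r normrN ger0_norm ?(ltW (q0 _))//; lra.
have S_cauchy f e : 0 < e -> exists k, forall n m, (k <= m)%N -> (m <= n)%N ->
    `|S n f - S m f| <= e.
  move=> e0; have [k [eta [eta0 sep]]] := Gsep (2 * (B + 1)) f e e0.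
  have [j jP] := q_small _ eta0.
  exists (maxn j k) => n m; rewrite geq_max => /andP[jm km] mn.
  apply: contfun_norm_le => [|t]; first exact: ltW.
  rewrite contfunB; apply: (sep (fun f => S n f t - S m f t)).
  - have [/(_ t)[lS _] _ _] := SP n; have [/(_ t)[lS' _] _ _] := SP m.
    by move=> a g h; rewrite lS lS'; ring.
  - move=> g; rewrite (le_trans (ler_normB _ _))//.
    by have := S_bound n t g; have := S_bound m t g; lra.
  - move=> g /(Gmono _ _ km) gG; have := S_tail m (n - m)%N g t gG.
    by rewrite subnKC//; have := jP _ jm; have := q0 n; lra.
have /choice[U UP] f : exists u : Y, (fun n => S n f) @ \oo --> u.
  apply/cvg_ex; apply: cauchy_cvg; apply/cauchyP => e e0.
  have e20 : 0 < e / 2 by rewrite divr_gt0.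
  have [k kP] := S_cauchy f _ e20.
  exists (S k f); exists k => // n /= kn.
  by rewrite -ball_normE /= distrC (le_lt_trans (kP _ _ (leqnn k) kn))//; lra.
have Ut f t : (fun n => S n f t) @ \oo --> U f t.
  apply/cvgrPdist_le => e e0; have /cvgrPdist_le/(_ e e0) := UP f.
  apply: filterS => n; apply: le_trans; rewrite -contfunB; exact: le_contfun_norm.
exists U; split=> [t|f].
  split=> [a f g|f f0].
    apply: (cvg_unique _ (Ut (a *: f + g) t)) => //.
    have -> : (fun n => S n (a *: f + g) t) = fun n => a * S n f t + S n g t.
      by apply/funext => n; have [/(_ t)[lS _] _ _] := SP n; rewrite lS.
    by apply: cvgD; [apply: cvgM; [exact: cvg_cst|]|]; exact: Ut.
  apply: (cvgr_to_ge (Ut f t)).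
  by apply: nearW => n; have [/(_ t)[_ S0] _ _] := SP n; exact: S0.
apply: contfun_norm_le => [|t].
  by rewrite mulr_ge0// addr_ge0 ?mulr_ge0// ltW.
rewrite contfunB; apply/ler_addgt0Pr => e e0.
have e20 : 0 < e / 2 by rewrite divr_gt0.
have [k [eta [eta0 sep]]] := Gsep (2 * (B + 1)) f _ e20.
have [j jP] := q_small _ eta0.
have /cvgrPdist_le/(_ _ e20)[i _ iP] := Ut f t.
pose n := maxn i (maxn j k).
have in_ : (i <= n)%N by exact: leq_maxl.
have jn : (j <= n)%N by rewrite /n; lia.
have kn : (k <= n)%N by rewrite /n; lia.
have [/(_ t)pS /(_ t)[lam [Pl lamS]] _] := SP n.
(* No [S n] need be a selection; for the given [f], closeness to [lam] on [G n] already yields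
   closeness at [f], so the bound on [Phi t] passes to the limit. *)
have h1 : `|S n f t - lam f| <= e / 2.
  apply: (sep (fun f => S n f t - lam f)).
  - by move=> a g h; rewrite pS.1 Pl.1.1; ring.
  - move=> g; rewrite (le_trans (ler_normB _ _))//.
    by have := S_bound n t g; have := Phi_bound _ _ Pl g; have := normr_ge0 g; lra.
  - move=> g /(Gmono _ _ kn) gG; rewrite distrC (le_trans (lamS _ gG))//.
    by have := jP _ jn; have := q0 n; lra.
have h2 := iP n in_; have h3 := Phi_dist_T f Pl.
rewrite (le_trans (ler_distD (S n f t) _ _))//.
have := ler_distD (lam f) (S n f t) (T f t); rewrite /= in h2; lra.
Qed.

End positive_selection.

Lemma near_positive_operator (R : realType) (K1 K2 : metricType R)
    (cK1 : compact [set: K1]) (cK2 : compact [set: K2])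
    (T : contfun cK1 -> contfun cK2) (M delta eps : R) :
  (forall t, linf (fun f => T f t)) -> 0 <= M -> 0 <= delta ->
  (forall f, `|T f| <= M * `|f|) ->
  (forall f t, cnneg f -> (forall x, f x <= 1) -> - delta <= T f t) ->
  0 < eps ->
  exists U : contfun cK1 -> contfun cK2,
    (forall t, positive (fun f => U f t)) /\
    forall f, `|U f - T f| <= (2 * delta + eps) * `|f|.
Proof.
move=> hT M0 delta0 TM Tdelta eps0.
have /choice[P PP] t := positive_part_exists (hT t)
  (fun f => le_trans (le_contfun_norm (T f) t) (TM f)).
have [P_pos P_ge P_approx] : [/\ forall t, positive (P t),
    forall t f, cnneg f -> T f t <= P t f &
    forall t f (e : R), cnneg f -> 0 < e -> exists g,
      [/\ cnneg g, forall x, g x <= f x & P t f < T g t + e]].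
  by split=> t; have [] := PP t.
exact: (positive_operator_near hT M0 delta0 TM Tdelta eps0 P_pos P_ge P_approx).
Qed.

(** * Piecewise linear cut-offs *)

Section ramps.
Context {R : realType}.
Implicit Types lo hi s : R.

Definition ramp lo hi s : R := Num.min 1 (Num.max 0 ((s - lo) / (hi - lo))).

(** The odd extension: for [0 <= lo < hi] it vanishes on [[-lo, lo]] and is the sign of [s] from
    [hi] on in absolute value. *)
Definition oramp lo hi s : R := ramp lo hi s - ramp lo hi (- s).

Lemma ramp_cts lo hi : continuous (ramp lo hi).
Proof.
move=> s; apply: (@continuous_min R R (fun=> 1)
  (fun s => Num.max 0 ((s - lo) / (hi - lo)))); first exact: cvg_cst.
apply: (@continuous_max R R (fun=> 0) (fun s => (s - lo) / (hi - lo))).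
  exact: cvg_cst.
apply: cvgM; last exact: cvg_cst.
by apply: cvgB; [exact: cvg_id|exact: cvg_cst].
Qed.

Lemma oramp_cts lo hi : continuous (oramp lo hi).
Proof.
move=> s; apply: cvgB; first exact: ramp_cts.
by apply: continuous_comp; [exact: opp_continuous|exact: ramp_cts].
Qed.

Lemma ramp_ge0 lo hi s : 0 <= ramp lo hi s.
Proof. by rewrite le_min ler01 le_max lexx. Qed.

Lemma ramp_le1 lo hi s : ramp lo hi s <= 1.
Proof. by rewrite ge_min lexx. Qed.

Lemma ramp0 lo hi s : lo < hi -> s <= lo -> ramp lo hi s = 0.
Proof.
move=> lh sl; rewrite /ramp max_l ?min_r//.
by rewrite ler_pdivrMr ?mul0r ?subr_le0// subr_gt0.
Qed.

Lemma ramp1 lo hi s : lo < hi -> hi <= s -> ramp lo hi s = 1.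
Proof.
move=> lh hs; rewrite /ramp min_l// le_max ler_pdivlMr ?subr_gt0//.
by rewrite mul1r lerD2r hs orbT.
Qed.

Lemma orampN lo hi s : oramp lo hi (- s) = - oramp lo hi s.
Proof. by rewrite /oramp opprK opprB. Qed.

Lemma oramp_pos lo hi s : 0 <= lo -> lo < hi -> 0 <= s ->
  oramp lo hi s = ramp lo hi s.
Proof.
by move=> lo0 lh s0; rewrite /oramp (ramp0 lh (s := - s)) ?subr0//; lra.
Qed.

Lemma oramp_norm_le1 lo hi s : `|oramp lo hi s| <= 1.
Proof.
have := (ramp_ge0 lo hi s, ramp_ge0 lo hi (- s)).
have := (ramp_le1 lo hi s, ramp_le1 lo hi (- s)).
by rewrite /oramp ler_norml => -[? ?] [? ?]; lra.
Qed.

Lemma oramp_sign lo hi s : 0 <= lo -> lo < hi -> oramp lo hi s != 0 ->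
  exists2 b : R, b = 1 \/ b = -1 & lo < b * s /\ `|oramp lo hi s| = b * oramp lo hi s.
Proof.
move=> lo0 lh; wlog s0 : s / 0 <= s => [H|].
  have [/H//|s0] := leP 0 s; rewrite -(opprK s) orampN oppr_eq0 normrN => h.
  have [|b b1 [lb E]] := H (- s) _ h; first by lra.
  exists (- b); first by case: b1 => ->; [right|left; rewrite opprK].
  by rewrite !mulrNN.
rewrite oramp_pos// => h; exists 1; first by left.
rewrite !mul1r ger0_norm ?ramp_ge0//; split=> //.
by rewrite ltNge; apply: contraNN h => sl; rewrite ramp0.
Qed.

Lemma oramp_sat lo hi s b : 0 <= lo -> lo < hi -> b = 1 \/ b = -1 ->
  hi <= b * s -> oramp lo hi s = b.
Proof.
move=> lo0 lh [] -> h.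
  by rewrite oramp_pos ?ramp1//; lra.
by rewrite -(opprK s) orampN oramp_pos ?ramp1//; lra.
Qed.

(* The three cut-offs of a value [v] of [x0] used below: [x1] is the modified
   value, equal to a sign where [1 - a <= `|v|]; [sg] selects the part of the
   measures which is kept; [q] is [1] on the support of [sg] and is itself
   supported where [x1] is a sign. *)
Lemma cutoff_facts (a v : R) : 0 < a -> a <= 8^-1 -> `|v| <= 1 ->
  let x1 := oramp 0 (1 - a) v in
  let sg := oramp (1 - a / 2) (1 - a / 4) v in
  let o := oramp (1 - a) (1 - a / 2) v in
  let q := o * o in
  [/\ sg * q = sg /\ q * (x1 * x1) = q,
      `|sg - sg * x1 * v| <= a / 2 /\ `|x1 - v| <= a,
      0 <= sg * x1 <= 1 /\ (1 - a / 4 <= `|v| -> sg * x1 = 1),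
      forall f, 0 <= f <= 1 -> `|v - sg * f| <= 1 &
      1 - a <= `|v| -> `|x1| = 1].
Proof.
move=> a0 a1; wlog v0 : v / 0 <= v => [H|].
  have [/H//|v0] := leP 0 v => v1.
  have := H (- v); rewrite normrN => /(_ _ v1) /=; rewrite !orampN !mulrNN !mulNr !mulrN.
  have vv : 0 <= - v by lra.
  move=> /(_ vv) [[/oppr_inj-> ->] [h1 h2] [h3 h4] h5 h6]; split=> //.
  - by rewrite -opprD normrN in h1; rewrite -opprD normrN in h2.
  - by move=> f /h5; rewrite mulNr -opprD normrN.
  - by move=> /h6; rewrite normrN.
rewrite ger0_norm// => v1 /=.
rewrite !oramp_pos//; try lra.
have A0 : 0 < 1 - a by lra.
have A1 : 1 - a < 1 - a / 2 by lra.
have A2 : 1 - a / 2 < 1 - a / 4 by lra.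
set x1 := ramp 0 _ _; set sg := ramp (1 - a / 2) _ _; set o := ramp (1 - a) _ _.
have x10 : 0 <= x1 := ramp_ge0 _ _ _; have x11 : x1 <= 1 := ramp_le1 _ _ _.
have sg0 : 0 <= sg := ramp_ge0 _ _ _; have sg1 : sg <= 1 := ramp_le1 _ _ _.
have o0 : 0 <= o := ramp_ge0 _ _ _; have o1 : o <= 1 := ramp_le1 _ _ _.
have x1E : 1 - a <= v -> x1 = 1 by move=> h; apply: ramp1.
have sgE : v <= 1 - a / 2 -> sg = 0 by move=> h; apply: ramp0.
have oE : 1 - a / 2 <= v -> o = 1 by move=> h; apply: ramp1.
have oE0 : v <= 1 - a -> o = 0 by move=> h; apply: ramp0.
have sgE1 : 1 - a / 4 <= v -> sg = 1 by move=> h; apply: ramp1.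
split.
- split.
    have [h|/ltW h] := leP v (1 - a / 2); first by rewrite sgE// mul0r.
    by rewrite oE// !mulr1.
  have [h|/ltW h] := leP v (1 - a); first by rewrite oE0// !mul0r.
  by rewrite x1E// !mulr1.
- split.
    have [h|h] := leP v (1 - a / 2); first by rewrite sgE// !mul0r subrr normr0; lra.
    rewrite x1E; last by lra.
    by rewrite mulr1 ger0_norm; nra.
  have [h|/ltW h] := leP v (1 - a); last by rewrite x1E// ger0_norm; lra.
  have E : x1 * (1 - a) = v.
    rewrite /x1 /ramp !subr0 max_r ?divr_ge0//; last exact: ltW.
    by rewrite min_r ?divfK ?gt_eqF// ler_pdivrMr// mul1r.
  by rewrite ger0_norm; nra.
- split; first by nra.
  by move=> h; rewrite sgE1// x1E ?mulr1//; lra.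
- move=> f f01; have [h|h] := leP v (1 - a / 2).
    by rewrite sgE// mul0r subr0 ger0_norm.
  by rewrite ler_norml; nra.
- by move=> h; rewrite x1E// normr1.
Qed.

End ramps.

(** * Modification of the functional *)

Section functional_part.
Context {R : realType} {K : metricType R} {cK : compact [set: K]}.
Local Notation C := (contfun cK).

(** Write [l = P - N]. Since [P (one - tau) + N (one + tau)] is below [eta], a Chebyshev estimate
    shows that [P] is almost carried by [tau] near 1 and [N] by [tau] near -1, up to a mass
    [u <= 4 * eta / d]. The functional is cut to these regions and divided by the remaining mass
    [c]; cutting costs [u], normalizing at most [eta + u]. *)
Lemma functional_near_face (l : C -> R) (tau : C) (d eta : R) :
  linf l -> (forall f, `|l f| <= `|f|) -> `|tau| <= 1 -> 0 < d -> d <= 1 ->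
  1 - eta < l tau -> eta + 8 * eta / d <= 2^-1 ->
  exists l1 : C -> R, [/\ linf l1, forall f, `|l1 f| <= `|f|,
    forall f, `|l1 f - l f| <= (eta + 8 * eta / d) * `|f| &
    forall z : C, (forall t, 1 - d / 2 <= tau t -> z t = 1) ->
      (forall t, 1 - d / 2 <= - tau t -> z t = -1) -> l1 z = 1].
Proof.
move=> ll lM tau1 d0 d1 ltau etad.
have lM1 f : `|l f| <= 1 * `|f| by rewrite mul1r.
have [P [pP lP Papp]] := positive_part_exists ll lM1.
pose N f := P f - l f.
have pN : positive N.
  split=> [a f g|f f0]; first by rewrite /N pP.1 ll; ring.
  by rewrite subr_ge0 lP.
pose one : C := cone.
have PN1 : P one + N one <= 1.
  apply/ler_addgt0Pr => e e0; have e20 : 0 < e / 2 by rewrite divr_gt0.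
  have [g [g0 g1 gP]] := Papp one _ (cnneg_cone (cK := cK)) e20.
  (* With [g] nearly attaining [P one], [l (2 *: g - one)] is nearly [P one + N one]: the norms of
     the two parts add up to that of [l]. *)
  have g2 : `|2 *: g - one| <= 1.
    apply: contfun_norm_le => // x; rewrite contfunB contfunZ ccstE ler_norml.
    by have := g0 x; have := g1 x; rewrite ccstE; lra.
  have := lM (2 *: g - one); rewrite (linfB ll) (linfZ ll) => h.
  have := le_trans (ler_norm _) h; rewrite /N; lra.
pose rr := ramp (1 - d / 2) (1 - d / 4).
have crr : continuous rr := @ramp_cts _ _ _.
have lt_d : 1 - d / 2 < 1 - d / 4 by lra.
pose h1 : C := ccomp crr tau; pose h2 : C := ccomp crr (- tau).
have h1E t : h1 t = rr (tau t) by [].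
have h2E t : h2 t = rr (- tau t) by [].
have tau_range t : -1 <= tau t <= 1 := contfun_unit_range t tau1.
pose c := P h1 + N h2.
pose u := P (one - h1) + N (one - h2).
have cE : c = P one + N one - u.
  by rewrite /c /u (linfB pP.1) (linfB pN.1); ring.
have rr_le s : s <= 1 -> 1 - rr s <= 4 / d * (1 - s).
  move=> s1; have d40 : 0 < 4 / d by rewrite divr_gt0.
  have [hs|hs] := leP (1 - d / 4) s.
    by rewrite /rr ramp1// subrr mulr_ge0 ?subr_ge0// ltW.
  have r0 : 0 <= rr s := ramp_ge0 _ _ _.
  rewrite (@le_trans _ _ 1)//; first by lra.
  by rewrite mulrAC ler_pdivlMr// mul1r; lra.
have ule : u <= 4 * eta / d.
  have E1 : P (one - h1) <= P ((4 / d) *: (one - tau)).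
    apply: positive_le => // t; rewrite contfunZ !contfunB ccstE h1E.
    by apply: rr_le; have := tau_range t; lra.
  have E2 : N (one - h2) <= N ((4 / d) *: (one + tau)).
    apply: positive_le => // t; rewrite contfunZ contfunB contfunD ccstE h2E.
    by rewrite -{2}(opprK (tau t)); apply: rr_le; have := tau_range t; lra.
  rewrite /u (le_trans (lerD E1 E2))// (linfZ pP.1) (linfZ pN.1).
  rewrite (linfB pP.1) (linfD pN.1).
  have -> : 4 / d * (P one - P tau) + 4 / d * (N one + N tau) =
    4 / d * (P one + N one - l tau) by rewrite /N; ring.
  by rewrite mulrAC ler_pM2r ?invr_gt0// ler_pM2l//; lra.
have ltau1 : l tau <= P one + N one.
  have /ltW h := ltau; rewrite -subr_ge0.
  have -> : P one + N one - l tau = P (one - tau) + N (one + tau).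
    by rewrite /N (linfB pP.1) (linfD pP.1) (linfD ll); ring.
  by rewrite addr_ge0//; [apply: pP.2|apply: pN.2] => t;
    rewrite ?contfunB ?contfunD ccstE; have := tau_range t; lra.
have ed : 8 * eta / d = 2 * (4 * eta / d) by ring.
have eta_d : 0 <= u.
  rewrite addr_ge0//; [apply: pP.2|apply: pN.2] => t; rewrite contfunB ccstE subr_ge0;
  exact: ramp_le1.
have eta0 : 0 < eta by lra.
have c0 : 0 < c by rewrite cE; lra.
have c1 : c <= 1 by rewrite cE; lra.
pose l1 f := c^-1 * (P (cmul h1 f) - N (cmul h2 f)).
have l1c f : c * l1 f = P (cmul h1 f) - N (cmul h2 f).
  by rewrite /l1 mulrA divff ?mul1r// gt_eqF.
have cut_le (l' : C -> R) h f : positive l' -> cnneg h ->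
    `|l' (cmul h f)| <= l' h * `|f|.
  move=> pl' h0; rewrite mulrC -(linfZ pl'.1); apply: positive_abs_le => // t.
  rewrite cmulE contfunZ normrM (ger0_norm (h0 t)) mulrC.
  by rewrite ler_wpM2r// le_contfun_norm.
have h10 : cnneg h1 by move=> t; exact: ramp_ge0.
have h20 : cnneg h2 by move=> t; exact: ramp_ge0.
have h11 : cnneg (one - h1).
  by move=> t; rewrite contfunB ccstE subr_ge0; exact: ramp_le1.
have h21 : cnneg (one - h2).
  by move=> t; rewrite contfunB ccstE subr_ge0; exact: ramp_le1.
have l1M f : `|l1 f| <= `|f|.
  rewrite /l1 normrM normfV (gtr0_norm c0) ler_pdivrMl//.
  rewrite (le_trans (ler_normB _ _))// /c mulrDl lerD//; exact: cut_le.
exists l1; split=> //.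
- move=> a f g; rewrite /l1 (linf_cmul h1 pP.1) (linf_cmul h2 pN.1); ring.
- move=> f; have E : c * l1 f - l f = N (cmul (one - h2) f) - P (cmul (one - h1) f).
    have split_one (l' : C -> R) h : linf l' ->
        l' (cmul (one - h) f) = l' f - l' (cmul h f).
      move=> hl'; rewrite -(linfB hl'); congr l'; apply: contfunP => t.
      by rewrite cmulE !contfunB cmulE ccstE; ring.
    by rewrite l1c (split_one _ _ pP.1) (split_one _ _ pN.1) /N; ring.
  have b1 : `|l1 f - c * l1 f| <= (1 - c) * `|f|.
    rewrite -{1}(mul1r (l1 f)) -mulrBl normrM ger0_norm ?subr_ge0//.
    by rewrite ler_wpM2l// subr_ge0.
  have b2 : `|c * l1 f - l f| <= u * `|f|.
    rewrite E (le_trans (ler_normB _ _))// /u mulrDl addrC lerD//; exact: cut_le.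
  rewrite (le_trans (ler_distD (c * l1 f) _ _))//.
  rewrite (le_trans (lerD b1 b2))// -mulrDl ler_wpM2r// cE ed; lra.
- move=> z z1 z2; have -> : l1 z = c^-1 * c.
    rewrite /l1; congr (_ * _); rewrite /c; congr (_ + _).
      congr P; apply: contfunP => t; rewrite cmulE h1E.
      have [h|/ltW h] := leP (1 - d / 2) (tau t); first by rewrite z1// mulr1.
      by rewrite /rr ramp0// mul0r.
    rewrite -(linfN pN.1); congr N; apply: contfunP => t.
    rewrite contfunN cmulE h2E.
    have [h|/ltW h] := leP (1 - d / 2) (- tau t); first by rewrite z2// mulrN1 opprK.
    by rewrite /rr ramp0// mul0r oppr0.
  by rewrite mulVf// gt_eqF.
Qed.

End functional_part.

Lemma linf_bound_homogeneous (R : realType) (V : normedModType R) (l : V -> R)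
    (c : R) : linf l -> (forall f, `|f| <= 1 -> `|l f| <= c) ->
  forall f, `|l f| <= c * `|f|.
Proof.
move=> ll lc f; have [->|f0] := eqVneq f 0.
  by rewrite (linf0 ll) !normr0 mulr0.
have n0 : 0 < `|f| by rewrite normr_gt0.
rewrite -ler_pdivrMr// -[X in _ / X]gtr0_norm// -normrV ?unitfE ?gt_eqF// -normrM.
rewrite mulrC -(linfZ ll); apply: lc.
by rewrite normrZ normfV normr_id mulVf// gt_eqF.
Qed.

(** * Modification of the operator *)

Section operator_part.
Context {R : realType} {K1 K2 : metricType R}.
Context {cK1 : compact [set: K1]} {cK2 : compact [set: K2]}.
Local Notation X := (contfun cK1).
Local Notation Y := (contfun cK2).

(** At each [t], [S] is a convex combination of [T _ t] and a sign times the normalized positive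
    functional [f |-> U (q * x1 * f) t / c t]. The signs in [S x1] are exact because
    [q * x1 * x1 = q], so the numerator at [x1] is [U q t = c t] itself. *)
Lemma operator_near_face (T : X -> Y) (x0 : X) (a : R) :
  (forall t, linf (fun f => T f t)) -> (forall f, `|T f| <= `|f|) ->
  `|x0| = 1 -> 0 < a -> a <= 8^-1 ->
  let d := a ^+ 2 / 32 in
  exists (S : X -> Y) (x1 : X), [/\ forall t, linf (fun f => S f t),
    forall f, `|S f| <= `|f| /\ `|S f - T f| <= 2 * a * `|f|,
    `|x1| = 1 /\ `|x1 - x0| <= a,
    forall t, 1 - d / 2 <= T x0 t -> S x1 t = 1 &
    forall t, 1 - d / 2 <= - T x0 t -> S x1 t = -1].
Proof.
move=> hT TM x01 a0 a1 d.
have d0 : 0 < d by rewrite divr_gt0// exprn_gt0.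
have da : 32 * d = a * a by rewrite /d expr2; field.
have dsmall : d <= a / 256 by nra.
have x0r x : `|x0 x| <= 1 by rewrite -x01 le_contfun_norm.
pose x1 : X := ccomp (@oramp_cts _ 0 (1 - a)) x0.
pose sg : X := ccomp (@oramp_cts _ (1 - a / 2) (1 - a / 4)) x0.
pose o : X := ccomp (@oramp_cts _ (1 - a) (1 - a / 2)) x0.
pose q : X := cmul o o.
have facts x : [/\ sg x * q x = sg x /\ q x * (x1 x * x1 x) = q x,
    `|sg x - sg x * x1 x * x0 x| <= a / 2 /\ `|x1 x - x0 x| <= a,
    0 <= sg x * x1 x <= 1 /\ (1 - a / 4 <= `|x0 x| -> sg x * x1 x = 1),
    forall f, 0 <= f <= 1 -> `|x0 x - sg x * f| <= 1 &
    1 - a <= `|x0 x| -> `|x1 x| = 1] by exact: cutoff_facts.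
pose tau := T x0.
(* [kk] already equals the sign wherever [kap] is nonzero: [kk] builds the almost positive family,
   [kap] glues the result with [T]. *)
pose kk : Y := ccomp (@oramp_cts _ (1 - 2 * d) (1 - d)) tau.
pose kap : Y := ccomp (@oramp_cts _ (1 - d) (1 - d / 2)) tau.
have Tt f t : `|T f t| <= `|f| := le_trans (le_contfun_norm _ _) (TM f).
have x1M x : `|x1 x| <= 1 by exact: oramp_norm_le1.
have sgM x : `|sg x| <= 1 by exact: oramp_norm_le1.
have kkM t : `|kk t| <= 1 by exact: oramp_norm_le1.
have kapM t : `|kap t| <= 1 by exact: oramp_norm_le1.
have q0 : cnneg q by move=> x; exact: sqr_ge0.
have q1 x : q x <= 1.
  have : `|o x| <= 1 by exact: oramp_norm_le1.
  by rewrite cmulE ler_norml; nra.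
have sgq f : cmul sg (cmul q f) = cmul sg f.
  by apply: contfunP => x; have [[h _] _ _ _ _] := facts x; rewrite !cmulE mulrA h.
have qxx : cmul q (cmul x1 x1) = q.
  by apply: contfunP => x; have [[_ h] _ _ _ _] := facts x; rewrite !cmulE h.
(* [b * T x0 t] close to [1] pins down the functional [f |-> T f t] near [x0]. *)
have face b t : b = 1 \/ b = -1 -> 1 - 2 * d <= b * tau t ->
    [/\ forall f, cnneg f -> (forall x, f x <= 1) -> - (2 * d) <= b * T (cmul sg f) t,
        forall f, `|T (f - cmul sg (cmul x1 f)) t| <= 8 * d / a * `|f| &
        1 - 2 * d - 8 * d / a - a / 2 <= b * T sg t].
  move=> b1 bt.
  have bT f : b * T f t <= `|f|.
    have := Tt f t; rewrite ler_norml; by case: b1 => ->; lra.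
  have rest f : `|f| <= 1 -> `|T (f - cmul sg (cmul x1 f)) t| <= 8 * d / a.
    move=> f1; pose w : X := f - cmul sg (cmul x1 f).
    change (`|T w t| <= 8 * d / a).
    (* [w] vanishes where [|x0|] is at least [1 - a / 4], so [x0] can be moved by [a / 4] times [w]
       in both directions inside the unit ball; as [b * T x0 t] is within [2 * d] of the maximum 1,
       [T w t] is at most [2 * d / (a / 4)]. *)
    have W e : `|e| <= a / 4 -> `|x0 + e *: w| <= 1.
      move=> ea; apply: contfun_norm_le => // x.
      rewrite contfunD contfunZ contfunB !cmulE mulrA.
      have [_ _ [h1 h2] _ _] := facts x.
      have -> : f x - sg x * x1 x * f x = (1 - sg x * x1 x) * f x by ring.
      have fx : `|f x| <= 1 := le_trans (le_contfun_norm f x) f1.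
      have [h|h] := leP (1 - a / 4) `|x0 x|.
        by rewrite (h2 h) subrr mul0r mulr0 addr0.
      rewrite (le_trans (ler_normD _ _))// !normrM.
      have s1 : `|1 - sg x * x1 x| <= 1 by rewrite ler_norml; move: h1; lra.
      have : `|1 - sg x * x1 x| * `|f x| <= 1 by rewrite mulr_ile1.
      have : `|e| * (`|1 - sg x * x1 x| * `|f x|) <= `|e|.
        by rewrite ler_piMr// mulr_ile1.
      lra.
    have a40 : 0 < a / 4 by lra.
    have e1 : b * T (x0 + (a / 4) *: w) t <= 1.
      by rewrite (le_trans (bT _))// W// gtr0_norm.
    have e2 : b * T (x0 + (- (a / 4)) *: w) t <= 1.
      by rewrite (le_trans (bT _))// W// normrN gtr0_norm.
    clearbody w; move: e1 e2; rewrite !(linfD (hT t)) !(linfZ (hT t)) -/tau => e1 e2.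
    rewrite ler_pdivlMr// -(gtr0_norm a0) -normrM ler_norml.
    by case: b1 bt e1 e2 => ->; lra.
  split.
  (* Subtracting [cmul sg f] keeps [x0] in the unit ball, so it cannot raise [b * T x0 t] above
     1. *)
  - move=> f f0 f1; have : b * T (x0 - cmul sg f) t <= 1.
      rewrite (le_trans (bT _))//; apply: contfun_norm_le => // x.
      rewrite contfunB cmulE; have [_ _ _ h _] := facts x.
      by apply: h; rewrite f0 f1.
    rewrite (linfB (hT t)) -/tau; lra.
  - apply: (@linf_bound_homogeneous R X
      (fun f => T (f - cmul sg (cmul x1 f)) t)) => // k g h.
    rewrite -(hT t); congr (T _ t); apply: contfunP => x.
    by rewrite !(contfunB, contfunD, contfunZ, cmulE); ring.
  - have h1 : `|T (x0 - cmul sg (cmul x1 x0)) t| <= 8 * d / a by apply: rest; rewrite x01.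
    have h2 : `|T (sg - cmul sg (cmul x1 x0)) t| <= a / 2.
      rewrite (le_trans (Tt _ _))//; apply: contfun_norm_le => [|x]; first by lra.
      by rewrite contfunB !cmulE mulrA; have [_ [h _] _ _ _] := facts x.
    move: h1 h2; rewrite !(linfB (hT t)) -/tau !ler_norml.
    by case: b1 bt => ->; lra.
have kk_sign t : kk t != 0 -> exists2 b : R, b = 1 \/ b = -1 &
    1 - 2 * d < b * tau t /\ `|kk t| = b * kk t.
  by apply: oramp_sign; lra.
pose T2 f : Y := cmul kk (T (cmul sg f)).
have hT2 t : linf (fun f => T2 f t).
  move=> k f g; rewrite /T2 !cmulE (linf_cmul sg (hT t)); ring.
have T2M f : `|T2 f| <= 1 * `|f|.
  rewrite mul1r; apply: contfun_norm_le => // t; rewrite cmulE normrM.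
  rewrite (le_trans (ler_piMl _ (kkM t)))// (le_trans (Tt _ t))//.
  apply: contfun_norm_le => // x; rewrite cmulE normrM.
  by rewrite (le_trans (ler_piMl _ (sgM x)))// le_contfun_norm.
have d20 : 0 <= 2 * d by lra.
have T2d f t : cnneg f -> (forall x, f x <= 1) -> - (2 * d) <= T2 f t.
  move=> f0 f1; rewrite cmulE; have [->|kt] := eqVneq (kk t) 0; first by lra.
  have [b b1 [/ltW bt kb]] := kk_sign t kt.
  have [/(_ f f0 f1) h _ _] := face b t b1 bt.
  have -> : kk t * T (cmul sg f) t = `|kk t| * (b * T (cmul sg f) t).
    by rewrite kb; case: b1 => ->; ring.
  have := kkM t; have := normr_ge0 (kk t); nra.
have [U [U_pos UT]] := near_positive_operator hT2 ler01 d20 T2M T2d d0.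
pose Q f := U (cmul q f).
pose c := U q.
have c0 t : 0 <= c t by apply: (U_pos t).2.
(* Truncating at [1/2] makes the inverse of [c] continuous on all of [K2]; where [kap] is nonzero,
   [c] is at least [1/2] and the truncation is inactive. *)
have cinv : continuous (fun s : R => (Num.max 2^-1 s)^-1).
  move=> s; apply: cvgV; first by rewrite gt_eqF// lt_max invr_gt0 ltr0Sn.
  apply: (@continuous_max R R (fun=> 2^-1) id); first exact: cvg_cst.
  exact: cvg_id.
pose den : Y := ccomp cinv c.
have denE t : den t = (Num.max 2^-1 (c t))^-1 by [].
have den0 t : 0 < den t by rewrite denE invr_gt0 lt_max invr_gt0 ltr0Sn.
have cden t : c t * den t <= 1.
  by rewrite denE ler_pdivrMr ?lt_max ?invr_gt0 ?ltr0Sn// mul1r le_max lexx orbT.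
have W_le f t : `|Q (cmul x1 f) t| <= c t * `|f|.
  rewrite mulrC -(linfZ (U_pos t).1); apply: (positive_abs_le (U_pos t)) => x.
  rewrite contfunZ !cmulE normrM (ger0_norm (q0 x)) mulrC ler_wpM2r//.
  by rewrite normrM (le_trans (ler_piMl _ (x1M x)))// le_contfun_norm.
pose cabs : R -> R := fun s => `|s|.
have ccabs : continuous cabs by move=> s; exact: norm_continuous.
pose S f : Y := T f - cmul (ccomp ccabs kap) (T f) +
  cmul kap (cmul den (Q (cmul x1 f))).
have SE f t : S f t = T f t - `|kap t| * T f t + kap t * (den t * Q (cmul x1 f) t).
  by [].
have kap_kk b t : b = 1 \/ b = -1 -> 1 - d < b * tau t -> kk t = b.
  by move=> b1 bt; apply: oramp_sat => //; lra.
have c_near b t : b = 1 \/ b = -1 -> 1 - d < b * tau t ->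
    `|1 - c t| <= 7 * d + 8 * d / a + a / 2.
  move=> b1 bt; have kb := kap_kk b t b1 bt.
  have [|_ _ h] := face b t b1; first by lra.
  have := le_trans (le_contfun_norm (U q - T2 q) t) (UT q).
  rewrite contfunB cmulE kb.
  have -> : cmul sg q = sg.
    by apply: contfunP => x; have [[e _] _ _ _ _] := facts x; rewrite cmulE.
  have qn : `|q| <= 1.
    by apply: contfun_norm_le => // x; rewrite ger0_norm.
  have : b * T sg t <= 1.
    have sgn : `|sg| <= 1 by exact: contfun_norm_le.
    by have := le_trans (Tt sg t) sgn; rewrite ler_norml; case: b1 => ->; lra.
  have : (2 * (2 * d) + d) * `|q| <= 5 * d.
    by rewrite [leRHS](_ : _ = (2 * (2 * d) + d) * 1); [rewrite ler_wpM2l//; lra|ring].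
  have : 0 <= 8 * d / a by rewrite divr_ge0// ltW// mulr_gt0.
  by rewrite -/c !ler_norml; lra.
(* The choice of [d] makes the error of the removed part a fixed fraction of [a]. *)
have da8 : 8 * d / a = a / 4.
  by rewrite /d expr2; field; rewrite gt_eqF.
have c_half b t : b = 1 \/ b = -1 -> 1 - d < b * tau t ->
    den t = (c t)^-1 /\ 2^-1 <= c t.
  move=> b1 bt; have := c_near b t b1 bt; rewrite da8 ler_norml denE => h.
  have ch : 2^-1 <= c t by lra.
  by rewrite max_r.
have S_face b t : b = 1 \/ b = -1 -> 1 - d / 2 <= b * tau t -> S x1 t = b.
  move=> b1 bt; have kb : kap t = b by apply: oramp_sat => //; lra.
  have bt' : 1 - d < b * tau t by lra.
  have [de ch] := c_half b t b1 bt'.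
  rewrite SE kb de /Q qxx -/c mulVf; last by rewrite gt_eqF//; lra.
  by case: b1 => ->; rewrite ?normrN normr1; ring.
exists S, x1; split.
- move=> t k f g; rewrite !SE.
  have -> : Q (cmul x1 (k *: f + g)) t = k * Q (cmul x1 f) t + Q (cmul x1 g) t.
    exact: (linf_cmul x1 (linf_cmul q (U_pos t).1)).
  by rewrite (hT t); ring.
- move=> f; split.
    apply: contfun_norm_le => // t; rewrite SE.
    have -> : T f t - `|kap t| * T f t + kap t * (den t * Q (cmul x1 f) t) =
      (1 - `|kap t|) * T f t + kap t * (den t * Q (cmul x1 f) t) by ring.
    have k1 := kapM t; rewrite (le_trans (ler_normD _ _))// !normrM.
    rewrite (ger0_norm (x := 1 - _)) ?subr_ge0// (gtr0_norm (den0 t)).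
    rewrite (_ : `|f| = (1 - `|kap t|) * `|f| + `|kap t| * `|f|); last by ring.
    rewrite lerD ?ler_wpM2l ?subr_ge0//.
    rewrite (le_trans (ler_wpM2l (ltW (den0 t)) (W_le f t)))//.
    by rewrite mulrA (mulrC (den t)) ler_piMl.
  apply: contfun_norm_le => [|t]; first by rewrite !mulr_ge0// ltW.
  have [kt|kt] := eqVneq (kap t) 0.
    rewrite contfunB SE kt normr0 !mul0r subr0 addr0 subrr normr0.
    by rewrite !mulr_ge0// ltW.
  have lo : 0 <= 1 - d by lra.
  have lh : 1 - d < 1 - d / 2 by lra.
  have [b b1 [bt kb]] := oramp_sign lo lh kt.
  have [de ch] := c_half b t b1 bt.
  have [|_ /(_ f) h _] := face b t b1; first by lra.
  pose W := Q (cmul x1 f) t.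
  have cn := c_near b t b1 bt.
  have c_gt0 : 0 < c t by lra.
  have w1 : `|den t * W - W| <= `|1 - c t| * `|f|.
    have -> : den t * W - W = (1 - c t) * (den t * W).
      by rewrite de; field; rewrite gt_eqF.
    rewrite normrM ler_wpM2l// normrM (gtr0_norm (den0 t)) de mulrC ler_pdivrMr//.
    by rewrite mulrC W_le.
  have w2 : `|W - b * T (cmul sg (cmul x1 f)) t| <= 5 * d * `|f|.
    have := le_trans (le_contfun_norm _ t) (UT (cmul q (cmul x1 f))).
    rewrite contfunB cmulE (kap_kk b t b1 bt) sgq => /le_trans; apply.
    rewrite (_ : 2 * (2 * d) + d = 5 * d); last by ring.
    rewrite ler_wpM2l//; first by lra.
    apply: contfun_norm_le => // x.
    rewrite cmulE normrM (ger0_norm (q0 x)) cmulE normrM.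
    rewrite (le_trans (ler_piMl _ (q1 x))) ?mulr_ge0//.
    by rewrite (le_trans (ler_piMl _ (x1M x)))// le_contfun_norm.
  have bb : b * b = 1 by case: b1 => ->; ring.
  have bn : `|b| = 1 by case: b1 => ->; rewrite ?normrN normr1.
  rewrite contfunB SE -/W kb.
  (* Three errors: normalization by [c], replacement of the almost positive family by [U], and the
     part of [T] removed by the cut-off. *)
  have -> : T f t - b * kap t * T f t + kap t * (den t * W) - T f t =
    kap t * ((den t * W - W) + (W - b * T (cmul sg (cmul x1 f)) t)
       - b * T (f - cmul sg (cmul x1 f)) t) by rewrite (linfB (hT t)); ring.
  rewrite normrM (le_trans (ler_piMl _ (kapM t)))//.
  rewrite (le_trans (ler_normB _ _))// normrM bn mul1r.
  have w3 := ler_normD (den t * W - W) (W - b * T (cmul sg (cmul x1 f)) t).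
  have tot : `|1 - c t| + 5 * d + 8 * d / a <= 2 * a by rewrite da8 in cn *; lra.
  have := ler_wpM2r (normr_ge0 f) tot; rewrite !mulrDl; lra.
- split.
    apply/eqP; rewrite eq_le contfun_norm_le//=.
    have [x xx] : exists x, 1 - a <= `|x0 x|.
      apply: contrapT => h; have : `|x0| <= 1 - a.
        apply: contfun_norm_le => [|x]; first by lra.
        by rewrite leNgt; apply/negP => hx; apply: h; exists x; exact: ltW.
      by rewrite x01; lra.
    have [_ _ _ _ /(_ xx) <-] := facts x; exact: le_contfun_norm.
  apply: contfun_norm_le => [|x]; first exact: ltW.
  by rewrite contfunB; have [_ [_ h] _ _ _] := facts x.
- by move=> t h; apply: S_face; [left|rewrite mul1r].
- by move=> t h; apply: S_face; [right|rewrite mulN1r].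
Qed.

End operator_part.

(** * Operator norms and bundling of linear maps *)

Section operator_norm.
Context {R : realType} {X Y : normedModType R}.

Lemma opnorm_le (T : X -> Y) (c : R) :
  (forall x, `|x| <= 1 -> `|T x| <= c) -> opnorm T <= c.
Proof.
move=> Tc; apply: ge_sup; first by exists `|T 0|, 0 => //=; rewrite normr0.
by move=> _ [x x1 <-]; exact: Tc.
Qed.

Lemma opnorm_eq1 (T : X -> Y) (x : X) :
  (forall x, `|T x| <= `|x|) -> `|x| = 1 -> `|T x| = 1 -> opnorm T = 1.
Proof.
move=> T1 x1 Tx; apply/eqP; rewrite eq_le opnorm_le/=; last first.
  by move=> z; exact: le_trans.
apply: ub_le_sup; last by exists x => //=; rewrite x1.
by exists 1 => _ [z z1 <-]; exact: le_trans (T1 z) z1.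
Qed.

Lemma opnorm1_le (T : {linear X -> Y}) : bounded_operator T -> opnorm T = 1 ->
  forall x, `|T x| <= `|x|.
Proof.
move=> [M TM] T1 x.
have Tub : has_ubound [set `|T x| | x in [set x : X | `|x| <= 1]].
  exists `|M| => _ [z z1 <-]; rewrite (le_trans (TM z))//.
  rewrite (@le_trans _ _ (`|M| * `|z|)) ?ler_wpM2r ?ler_norm//.
  by rewrite ler_piMr.
have [->|x0] := eqVneq x 0; first by rewrite linear0 normr0.
have n0 : 0 < `|x| by rewrite normr_gt0.
have : `|T (`|x|^-1 *: x)| <= 1.
  rewrite -T1; apply: ub_le_sup => //; exists (`|x|^-1 *: x) => //=.
  by rewrite normrZ normfV normr_id mulVf// gt_eqF.
by rewrite linearZ normrZ normfV normr_id ler_pdivrMl// mulr1.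
Qed.

Lemma bounded_operator1 (T : X -> Y) :
  (forall x, `|T x| <= `|x|) -> bounded_operator T.
Proof. by move=> T1; exists 1 => x; rewrite mul1r. Qed.

Lemma bounded_operator_continuous (T : {linear X -> Y}) :
  bounded_operator T -> continuous T.
Proof.
move=> [M TM]; apply: bounded_linear_continuous; apply/linear_boundedP.
near=> r => x; rewrite (le_trans (TM x))// ler_wpM2r//.
Unshelve. all: by end_near. Qed.

Lemma continuous_bounded_operator (T : {linear X -> Y}) :
  continuous T -> bounded_operator T.
Proof.
move=> cT; have /linear_boundedP := (linear_bounded_continuous T).2 cT.
by move=> /pinfty_ex_gt0[M M0 TM]; exists M.
Qed.

Lemma linear_packing (T : X -> Y) : linear T -> exists L : {linear X -> Y}, L =1 T.
Proof.
move=> lT; pose l := GRing.isLinear.Build R X Y *:%R T lT.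
pose L : {linear X -> Y} := HB.pack T l.
by exists L.
Qed.

End operator_norm.

(** * Assembly of the approximating triple *)

Section main.
Context {R : realType} {K1 K2 : metricType R}.
Context {cK1 : compact [set: K1]} {cK2 : compact [set: K2]}.
Local Notation X := (contfun cK1).
Local Notation Y := (contfun cK2).

(** The two modifications meet at the threshold [1 - d / 2] for [T x0]: there [S x1] takes the signs
    required of [z] in [functional_near_face], so [z = S x1] gives the value 1. The norms of [S x1],
    [S] and [y1] are then forced to be 1. *)
Lemma BPBZ_approximation (a : R) (T : {linear X -> Y})
    (y0 : {linear Y -> R^o}) (x0 : X) :
  0 < a -> a <= 8^-1 ->
  bounded_operator T -> opnorm T = 1 -> continuous y0 -> opnorm y0 = 1 ->
  `|x0| = 1 -> 1 - a ^+ 3 / 512 < y0 (T x0) ->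
  exists (y1 : {linear Y -> R^o}) (x1 : X) (S : {linear X -> Y}),
    [/\ continuous y1 /\ opnorm y1 = 1, `|x1| = 1, bounded_operator S,
        opnorm S = 1 /\ `|y1 (S x1)| = 1 &
        [/\ `|x1 - x0| <= a, opnorm (y1 \- y0) <= a & opnorm (S \- T) <= 2 * a]].
Proof.
move=> a0 a1 bT T1 cy0 y01 x01 yT.
have TM := opnorm1_le bT T1.
have yM := opnorm1_le (continuous_bounded_operator cy0) y01.
have hT t : linf (fun f => T f t).
  by move=> k f g; rewrite linearD linearZ contfunD contfunZ.
have hy : linf (y0 : Y -> R) by move=> k f g; rewrite linearD linearZ.
have [S [x1 [hS SM [x11 x1x0] S1 S2]]] := operator_near_face hT TM x01 a0 a1.
pose d := a ^+ 2 / 32.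
have d0 : 0 < d by rewrite divr_gt0// exprn_gt0.
have da : 32 * d = a * a by rewrite /d expr2; field.
have d1 : d <= 1 by nra.
(* The second term is exactly [a / 2], and the first is far below [a / 2]. *)
have etaE : a ^+ 3 / 512 + 8 * (a ^+ 3 / 512) / d <= a.
  have -> : 8 * (a ^+ 3 / 512) / d = a / 2 by rewrite /d; field; rewrite gt_eqF.
  have -> : a ^+ 3 = a * (a * a) by rewrite !exprS expr0 mulr1.
  by nra.
have tau1 : `|T x0| <= 1 by rewrite -x01.
have eta2 : a ^+ 3 / 512 + 8 * (a ^+ 3 / 512) / d <= 2^-1 by lra.
have [l1 [ll1 l1M l1y l1z]] := functional_near_face hy yM tau1 d0 d1 yT eta2.
have [y1 y1E] : exists y1 : {linear Y -> R^o}, y1 =1 l1.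
  by apply: linear_packing => k f g; exact: ll1.
have [S' S'E] : exists S' : {linear X -> Y}, S' =1 S.
  by apply: linear_packing => k f g; apply: contfunP => t; rewrite hS.
have yS : y1 (S' x1) = 1 by rewrite y1E S'E; apply: l1z.
have y1M y : `|y1 y| <= `|y| by rewrite y1E; exact: l1M.
have S'M f : `|S' f| <= `|f| by rewrite S'E; have [] := SM f.
have Sx1 : `|S' x1| = 1.
  apply/eqP; rewrite eq_le -{1}x11 S'M/=.
  by rewrite (le_trans _ (y1M _))// yS normr1.
exists y1, x1, S'; split=> //.
- split; first exact/bounded_operator_continuous/bounded_operator1.
  by apply: (opnorm_eq1 y1M Sx1); rewrite yS normr1.
- exact: bounded_operator1.
- by split; [exact: (opnorm_eq1 S'M x11)|rewrite yS normr1].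
- split=> //.
    apply: opnorm_le => f f1; rewrite /= y1E (le_trans (l1y f))//.
    by rewrite (le_trans (ler_wpM2r _ etaE))// ler_piMr// ltW.
  apply: opnorm_le => f f1; rewrite /= S'E; have [_ h] := SM f.
  by rewrite (le_trans h)// ler_piMr// mulr_ge0// ltW.
Qed.

End main.

Theorem corollary2p8 (R : realType) (K1 K2 : metricType R)
  (cK1 : compact [set: K1]) (cK2 : compact [set: K2]) :
  BPBZp (contfun cK1) (contfun cK2).
Proof.
move=> eps eps0; pose a := Num.min eps 1 / 8.
have m0 : 0 < Num.min eps 1 by rewrite lt_min eps0 ltr01.
have a0 : 0 < a by rewrite divr_gt0.
have a1 : a <= 8^-1 by rewrite ler_pdivrMr// mulVf// ge_min lexx orbT.
have ae : 2 * a < eps.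
  have : Num.min eps 1 <= eps by rewrite ge_min lexx.
  by rewrite /a; lra.
have a_eps : a < eps by lra.
exists (a ^+ 3 / 512); first exact: divr_gt0 (exprn_gt0 3 a0) (ltr0Sn R 511).
move=> T y0 x0 bT T1 cy0 y01 x01.
rewrite ltr_normr => /orP[h|h].
  have [y1 [x1 [S [h1 h2 h3 h4 [h5 h6 h7]]]]] :=
    BPBZ_approximation a0 a1 bT T1 cy0 y01 x01 h.
  exists y1, x1, S; split=> //; split.
  - exact: le_lt_trans h5 _.
  - exact: le_lt_trans h6 _.
  - exact: le_lt_trans h7 _.
(* A value close to -1 is treated by passing to [- x0], and the resulting [x1] is negated back. *)
have nx01 : `|- x0| = 1 by rewrite normrN.
have hn : 1 - a ^+ 3 / 512 < y0 (T (- x0)) by rewrite !linearN.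
have [y1 [x1 [S [h1 h2 h3 [h4 h8] [h5 h6 h7]]]]] :=
  BPBZ_approximation a0 a1 bT T1 cy0 y01 nx01 hn.
exists y1, (- x1), S; split=> //.
- by rewrite normrN.
- by split=> //; rewrite !linearN normrN.
- split.
  + by rewrite -opprD normrN (le_lt_trans _ a_eps)// -[x0]opprK.
  + exact: le_lt_trans h6 _.
  + exact: le_lt_trans h7 _.
Qed.
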